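(* Let $G$ be an $n$-node graph with maximum degree $\Delta$. Consider the $(deg+1)$-list coloring problem where each node $v$ has a list $L_v\subseteq\mathcal{C}$ with $|L_v|\ge \deg(v)+1$, from a color space of size $|\mathcal{C}|=2^{\mathrm{poly}(\Delta)}$. This problem can be solved in $O\big(\sqrt{\Delta\log\Delta}\big)+\frac{1}{2}\log^* n$ rounds in the LOCAL model. Furthermore, each node only needs to broadcast to its neighbors a single non-CONGEST message, consisting of a subset of its list.
   Context: List coloring: each node $v$ must output a color $c(v)\in L_v$ such that adjacent nodes output different colors. $\mathrm{poly}(X)$ means $O(X^c)$ for an absolute constant $c$. LOCAL model: synchronous rounds on the network graph $G$ whose nodes have unique $O(\log n)$-bit identifiers; per round, each node may send one message of unbounded size to each neighbor. CONGEST model: same as LOCAL but each message is limited to $O(\log n)$ bits; a ''non-CONGEST message'' is a message exceeding this bound. *)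

(* Defs.v *)
From mathcomp Require Import all_boot.

Set Implicit Arguments.
Unset Strict Implicit.
Unset Printing Implicit Defensive.

Lemma log_star_ex (n : nat) : exists k, iter k (up_log 2) n <= 1.
Proof.
have [m] := ubnP n; elim: m n => // m IHm n lt_n.
case: (leqP n 1) => [le_n1|lt_1n]; first by exists 0.
have lt_up : up_log 2 n < n.
  case: n {lt_n} lt_1n => // n lt_0n; rewrite ltnS.
  exact: up_log_min (ltn_expl n (ltnSn 1)).
have [k le_k] := IHm (up_log 2 n) (leq_trans lt_up lt_n).
by exists k.+1; rewrite iterSr.
Qed.

(* The number of iterations of log2 needed to bring [n] down to at most 1.
   Rounding each logarithm up does not change it: for a natural number m,
   log2 x <= m iff up_log 2 x <= m. *)
Definition log_star (n : nat) : nat := ex_minn (log_star_ex n).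

Record graph := Graph {
  vertex :> finType;
  adj : rel vertex;
  adj_sym : symmetric adj;
  adj_irr : irreflexive adj
}.

Definition deg (G : graph) (v : G) : nat := #|[set u | adj v u]|.

Definition max_deg (G : graph) : nat := \max_(v : G) deg v.

Definition is_list_coloring (G : graph) (C : finType) (L : G -> {set C})
    (col : G -> C) : Prop :=
  (forall v, col v \in L v) /\ (forall u v, adj u v -> col u != col v).

(* [ports v] lists the neighbors of [v]; nodes address their neighbors only
   through the positions in this list, whose order is arbitrary. *)
Record network (G : graph) := Network {
  node_id : G -> bitseq;
  node_id_inj : injective node_id;
  ports : G -> seq G;
  ports_uniq : forall v, uniq (ports v);
  mem_ports : forall v u, (u \in ports v) = adj v u
}.

(* A deterministic synchronous algorithm with local inputs in [I], messages in
   [M] and outputs in [O].  A node starts from its degree, identifier and input;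
   in each round it sends [send s p] through port [p] and then updates its state
   from the messages received, listed by port.  Neither the messages nor the
   local computations are restricted. *)
Record local_alg (I M O : Type) := LocalAlg {
  state : Type;
  init : nat -> bitseq -> I -> state;
  send : state -> nat -> M;
  recv : state -> seq M -> state;
  output : state -> option O  (* [None]: no output *)
}.

Section Execution.
Variables (I M O : Type) (A : local_alg I M O).
Variables (G : graph) (N : network G) (inp : G -> I).

Fixpoint run (t : nat) (v : G) : state A :=
  if t is t'.+1 then
    recv (run t' v)
      [seq send (run t' u) (index v (ports N u)) | u <- ports N v]
  else init A (deg v) (node_id N v) (inp v).

(* The message from [v] to its neighbor [w] in round [t]; rounds are numbered
   from 0. *)
Definition sent (t : nat) (v w : G) : M :=
  send (run t v) (index w (ports N v)).

End Execution.

Inductive message (C : finType) :=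
  | Bits of bitseq
  | ColorSet of {set C}.

Definition congest_msg (C : finType) (s : nat) (m : message C) : Prop :=
  if m is Bits w then size w <= s else False.

(* During rounds 0, ..., T-1, node [v] sends messages of at most [s] bits, except
   possibly in one round [r] (none if [T <= r]), in which it sends all its
   neighbors the same subset of its list. *)
Definition single_list_broadcast (C : finType) (O : Type)
    (A : local_alg {set C} (message C) O) (G : graph) (N : network G)
    (L : G -> {set C}) (T s : nat) (v : G) : Prop :=
  exists (r : nat) (S : {set C}), S \subset L v /\
    forall t w, t < T -> adj v w ->
      if t == r then sent A N L t v w = ColorSet S
      else congest_msg s (sent A N L t v w).

(* Main.v *)
Require Import Defs.
From mathcomp Require Import all_boot all_order all_algebra.
From mathcomp Require Import reals exp.
From mathcomp Require Import finfield ring lra zify.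
From Stdlib Require Import FunctionalExtensionality.
Set Implicit Arguments.
Unset Strict Implicit.
Unset Printing Implicit Defensive.

(* Identifiers are first reduced to a proper coloring with poly(Delta) colors.
   Each round of Szegedy-Vishwanathan reduction replaces the bit length of the
   colors by its iterated logarithm of order two, up to a factor poly(Delta), so
   (log* n)/2 rounds leave poly(Delta) bits, and one round of Linial's reduction
   leaves O(log Delta) bits.

   List coloring then proceeds in levels. A level handles an uncolored graph of
   maximum degree Delta' with beta = Theta(sqrt(Delta' / log Delta)). In q rounds
   the nodes distribute themselves over q = O(Delta' / beta) classes so that each
   has at most beta neighbors that joined its class no later than itself: a node
   tries the values of its own polynomial at successive points and settles at the
   first value shared by at most beta neighbors. The classes are then
   treated one by one; a node whose remaining list has at least
   l = 16 beta^2 lam = O(beta^2 log Delta) colors broadcasts l of them and is colored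
   by a list version of Linial's reduction, in O(1) rounds. The nodes
   left uncolored have fewer than l remaining colors, hence fewer than l uncolored
   neighbors, so with l = Delta'/4 the cost of the levels decreases geometrically
   from O(sqrt(Delta log Delta)). At the last level beta = 0 and l = 1. *)

(** * Encoding numbers and polynomial codes *)

Fixpoint bits_succ (w : bitseq) : bitseq :=
  match w with
  | [::] => [:: false]
  | false :: w' => true :: w'
  | true :: w' => false :: bits_succ w'
  end.

(* The leading bit 1 is left implicit, which makes [nat_of_bits] a bijection. *)
Definition bits_val (w : bitseq) : nat := foldr (fun (b : bool) a => b + a.*2) 1 w.

Definition nat_of_bits (w : bitseq) : nat := (bits_val w).-1.
Definition bits_of_nat (x : nat) : bitseq := iter x bits_succ [::].

Lemma bits_val_bounds w : 2 ^ size w <= bits_val w < 2 ^ (size w).+1.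
Proof.
elim: w => //= b w /andP[IH1 IH2]; rewrite !expnS in IH2 *.
by case: b; lia.
Qed.

Lemma bits_val_succ w : bits_val (bits_succ w) = (bits_val w).+1.
Proof. by elim: w => //= -[] w IH //=; rewrite IH; lia. Qed.

Lemma bits_of_natK : cancel bits_of_nat nat_of_bits.
Proof.
move=> x; rewrite /nat_of_bits.
suff -> : bits_val (bits_of_nat x) = x.+1 by [].
by elim: x => //= x IH; rewrite bits_val_succ IH.
Qed.

Lemma nat_of_bits_inj : injective nat_of_bits.
Proof.
have pos w : 0 < bits_val w.
  by have /andP[+ _] := bits_val_bounds w; apply: leq_trans; rewrite expn_gt0.
suff inj : injective bits_val.
  by move=> u v; rewrite /nat_of_bits => e; apply: inj; move: (pos u) (pos v); lia.
elim=> [|b u IH] [|b' v] //=; rewrite -/(bits_val _) => e.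
- by move: (pos v) e; case: b'; rewrite /bits_val /=; lia.
- by move: (pos u) e; case: b; rewrite /bits_val /=; lia.
- rewrite -/(bits_val u) in e.
  have [-> ev] : b = b' /\ bits_val u = bits_val v by case: b b' e => -[] e; lia.
  by rewrite (IH _ ev).
Qed.

Lemma ltn_nat_of_bits w : nat_of_bits w < 2 ^ (size w).+1.
Proof. by have /andP[_] := bits_val_bounds w; rewrite /nat_of_bits; lia. Qed.

Lemma size_bits_of_nat x l : x < 2 ^ l -> size (bits_of_nat x) <= l.
Proof.
move=> xl; rewrite -(@leq_exp2l 2) //.
have /andP[+ _] := bits_val_bounds (bits_of_nat x).
move=> h; apply: leq_trans h _; have := bits_of_natK x.
by rewrite /nat_of_bits; lia.
Qed.

Section Code.
Import GRing.Theory.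
Local Open Scope ring_scope.

Lemma card_root (F : finFieldType) (p : {poly F}) d :
  p != 0 -> (size p <= d.+1)%N -> (#|[set t | root p t]| <= d)%N.
Proof.
move=> p0 sp; rewrite cardE -ltnS; apply: leq_trans sp.
apply: max_poly_roots => //; last exact: enum_uniq.
by apply/allP => t; rewrite mem_enum inE.
Qed.

(* Monic polynomials of degree [d], evaluated at the points of GF(2^k). *)
Lemma agreement_code k d : (0 < k)%N -> (0 < d)%N ->
  exists f : nat -> nat -> nat,
  [/\ forall x t, (f x t < 2 ^ k)%N,
      forall x y, (x < 2 ^ (k * d))%N -> (y < 2 ^ (k * d))%N -> x != y ->
        (#|[set t : 'I_(2 ^ k) | f x t == f y t]| <= d)%N
    & forall x b, (#|[set t : 'I_(2 ^ k) | f x t == b]| <= d)%N].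
Proof.
move=> k0 d0; have [F _ cardF] := pPrimePowerField (isT : prime 2) k0.
have cardX : #|{ffun 'I_d -> F}| = (2 ^ (k * d))%N.
  by rewrite card_ffun card_ord cardF expnM.
pose g (x : nat) : {ffun 'I_d -> F} := nth [ffun=> 0] (enum {ffun 'I_d -> F}) x.
pose co x i : F := oapp (g x) 0 (insub i).
(* The term ['X^d] cancels in [P x - P y] but keeps [P x - b] nonzero for every constant [b]; both
   differences thus have at most [d] roots. *)
pose P x : {poly F} := 'X^d + \poly_(i < d) co x i.
have sQ x : (size (\poly_(i < d) co x i) < d.+1)%N.
  by rewrite ltnS size_poly.
pose e (t : nat) : F := nth 0 (enum F) t.
have szF : size (enum F) = (2 ^ k)%N by rewrite -cardE.
have e_inj (t u : nat) : (t < 2 ^ k)%N -> (u < 2 ^ k)%N -> e t = e u -> t = u.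
  by rewrite -szF => *; apply/eqP; rewrite -(nth_uniq 0 _ _ (enum_uniq F)) //; apply/eqP.
exists (fun x t => index ((P x).[e t]) (enum F)); split.
- by move=> x t; rewrite -szF index_mem mem_enum.
- move=> x y; rewrite -cardX => xl yl xy.
  have gxy : g x != g y by rewrite nth_uniq ?enum_uniq // -cardE.
  pose p := P x - P y.
  have p0 : p != 0.
    apply: contra_neq gxy => /eqP; rewrite subr_eq0 => /eqP/addrI.
    move=> /polyP pq; apply/ffunP => i; have := pq i; rewrite !coef_poly ltn_ord.
    by rewrite /co !valK.
  have sp : (size p <= d.+1)%N.
    rewrite /p opprD addrACA subrr add0r (leq_trans (size_polyD _ _)) //.
    by rewrite size_polyN geq_max !(ltnW (sQ _)).
  apply: leq_trans (card_root p0 sp).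
  rewrite -(card_in_imset (f := fun t : 'I_(2 ^ k) => e t)); last first.
    by move=> t u _ _ /e_inj tu; apply/val_inj/tu.
  apply/subset_leq_card/subsetP => _ /imsetP[t + ->]; rewrite !inE => /eqP.
  move=> /(congr1 (nth 0 (enum F))); rewrite !nth_index ?mem_enum // => h.
  by rewrite /root /p hornerD hornerN h subrr.
- move=> x b; case: (ltnP b (2 ^ k)) => [bl|bl]; last first.
    rewrite (_ : [set _ | _] = set0) ?cards0 //; apply/setP => t; rewrite !inE.
    apply: contraTF bl => /eqP <-; rewrite -ltnNge.
    by move: (index_mem (P x).[e t] (enum F)); rewrite szF mem_enum.
  pose p := P x - (e b)%:P.
  have sp : size p = d.+1.
    rewrite /p /P -addrA size_polyDl ?size_polyXn // (leq_ltn_trans (size_polyD _ _)) //.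
    by rewrite size_polyN gtn_max ltnS size_poly size_polyC ltnS (leq_trans (leq_b1 _)).
  have p0 : p != 0 by rewrite -size_poly_eq0 sp.
  have := card_root p0 (eq_leq sp); apply: leq_trans.
  rewrite -(card_in_imset (f := fun t : 'I_(2 ^ k) => e t)); last first.
    by move=> t u _ _ /e_inj tu; apply/val_inj/tu.
  apply/subset_leq_card/subsetP => _ /imsetP[t + ->]; rewrite !inE => /eqP bE.
  by rewrite /root /p hornerD hornerN hornerC -bE {2}/e nth_index ?mem_enum // subrr.
Qed.
End Code.

(** * One-round color reductions *)

(* [F x ys] is the new color of a node of color [x] whose neighbors have the colors [ys]. *)
Definition reduction D l l' (F : nat -> seq nat -> nat) :=
  (forall x ys, F x ys < 2 ^ l') /\
  forall x y xs ys, x < 2 ^ l -> y < 2 ^ l ->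
    size xs <= D -> size ys <= D -> all (ltn^~ (2 ^ l)) xs -> all (ltn^~ (2 ^ l)) ys ->
    y \in xs -> x \in ys -> x \notin xs -> y \notin ys -> F x xs != F y ys.

Definition bit (x i : nat) : bool := odd (x %/ 2 ^ i).

Lemma bit_ext l x y : x < 2 ^ l -> y < 2 ^ l ->
  (forall i, i < l -> bit x i = bit y i) -> x = y.
Proof.
elim: l x y => [|l IH] x y; first by case: x; case: y.
rewrite !expnS => xl yl bits.
have e0 := bits 0 isT; rewrite /bit expn0 !divn1 in e0.
rewrite -(odd_double_half x) -(odd_double_half y) e0; congr (_ + _.*2).
apply: IH => [||i il]; try lia.
by have := bits i.+1 il; rewrite /bit expnS !divnMA !divn2.
Qed.

(** Union bound: the sets ruled out by the members of [Q] are together too small to cover [I]. *)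
Lemma exists_avoiding (T : eqType) (I : finType) (P : T -> pred I) (Q : seq T) d :
  (forall q, q \in Q -> #|[set i | P q i]| <= d) -> size Q * d < #|I| ->
  exists i, all (fun q => ~~ P q i) Q.
Proof.
move=> Pd szQ; apply/existsP; apply: contraLR szQ; rewrite negb_exists -leqNgt.
move=> /forallP noI; rewrite -cardsT.
have: [set: I] \subset \bigcup_(q <- Q) [set i | P q i].
  apply/subsetP => i _; have := noI i; rewrite -has_predC => /hasP[q qQ /negPn h].
  by rewrite (big_rem q) //= !inE h.
move/subset_leq_card/leq_trans; apply.
elim: Q Pd {noI} => [|q Q IH] Pd; first by rewrite big_nil cards0.
rewrite big_cons /= mulSn (leq_trans (leq_card_setU _ _)) // leq_add ?Pd ?mem_head //.
by apply: IH => q' q'Q; rewrite Pd // inE q'Q orbT.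
Qed.

Lemma exists_sep_point k d (f : nat -> nat -> nat) (P : seq (nat * nat)) :
  (forall p, p \in P -> #|[set t : 'I_(2 ^ k) | f p.1 t == f p.2 t]| <= d) ->
  size P * d < 2 ^ k ->
  exists t : 'I_(2 ^ k), all (fun p => f p.1 t != f p.2 t) P.
Proof.
move=> agree szP.
by apply: (@exists_avoiding _ _ (fun p (t : 'I__) => f p.1 t == f p.2 t)) agree _; rewrite card_ord.
Qed.

(** Colors are read as polynomials of degree [l] over GF(2^k). Agreements with neighbors rule out
    fewer than [2 ^ k] points, so a node finds a point where it differs from all of them; its new
    color is that point together with the value there. *)
Lemma linial_reduction D l k : 0 < k -> 0 < l -> D * l < 2 ^ k ->
  exists F, reduction D l (2 * k) F.
Proof.
move=> k0 l0 Dlk; have [f [fl agree _]] := agreement_code k0 l0.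
have t0 : 'I_(2 ^ k) by apply: (@Ordinal _ 0); rewrite expn_gt0.
pose sep x ys (t : 'I_(2 ^ k)) := all (fun y => f x t != f y t) ys.
pose T x ys := odflt t0 [pick t | sep x ys t].
have TP x ys : x < 2 ^ l -> size ys <= D -> all (ltn^~ (2 ^ l)) ys -> x \notin ys ->
    sep x ys (T x ys).
  move=> xl sys /allP ysl xys; rewrite /T; case: pickP => //= none.
  have le_l : 2 ^ l <= 2 ^ (k * l) by rewrite leq_exp2l // leq_pmull.
  have [||t] := @exists_sep_point k l f [seq (x, y) | y <- ys].
  - move=> _ /mapP[y yys ->] /=; apply: agree; first exact: leq_trans le_l.
      by apply: leq_trans le_l; apply: ysl.
    by apply: contraNneq xys => ->.
  - by rewrite size_map (leq_ltn_trans _ Dlk) // leq_mul2r sys orbT.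
  - by rewrite all_map => h; have := none t; rewrite /sep h.
exists (fun x ys => T x ys * 2 ^ k + f x (T x ys)); split.
  move=> x ys; rewrite mul2n -addnn expnD.
  have := fl x (T x ys); have := ltn_ord (T x ys); nia.
move=> x y xs ys xl yl sxs sys xsl ysl yxs xys nx ny; apply/eqP => e.
have /allP/(_ y yxs) := TP x xs xl sxs xsl nx.
have eT : T x xs = T y ys :> nat.
  have := congr1 (divn^~ (2 ^ k)) e; have fx := fl x (T x xs); have fy := fl y (T y ys).
  by rewrite !divnMDl ?expn_gt0 // !divn_small // !addn0.
by move: e; rewrite eT => /addnI ->; rewrite eqxx.
Qed.

(* Szegedy-Vishwanathan: each edge [xy] is labelled by the first bit where the
   colors [x] and [y] differ, so the labels [Out] of the edges on which a node
   has bit 0 and the labels [In] of its other edges are disjoint, and the label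
   of an edge is in [Out] of one end and in [In] of the other. The new color is
   a hash point [t] separating [Out] from [In] with the hash values of [Out]. *)
Lemma sv_reduction D l k : 0 < k -> 1 < l -> D * D * up_log 2 l < 2 ^ k ->
  exists F, reduction D l ((D + 1) * (k + 1)) F.
Proof.
move=> k0 l1 Dk; pose d := up_log 2 l.
have d0 : 0 < d by rewrite up_log_gt0 l1.
have [f [fl agree _]] := agreement_code k0 d0.
set q := 2 ^ k in fl agree Dk.
have t0 : 'I_q by apply: (@Ordinal _ 0); rewrite expn_gt0.
pose dif x y := find (fun i => bit x i != bit y i) (iota 0 l).
have difC x y : dif x y = dif y x by apply: eq_find => i; rewrite eq_sym.
pose Lab b x ys := [seq dif x y | y <- ys & bit x (dif x y) == b].
pose sep x ys (t : 'I_q) :=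
  all (fun p => f p.1 t != f p.2 t) [seq (i, j) | i <- Lab false x ys, j <- Lab true x ys].
pose T x ys := odflt t0 [pick t | sep x ys t].
pose code x ys : seq nat := (T x ys : nat) :: [seq f i (T x ys) | i <- Lab false x ys].
(* [q] is no hash value, so it can pad the code to the fixed length [D.+1]. *)
pose col x ys : {ffun 'I_D.+1 -> 'I_q.+1} := [ffun j : 'I_D.+1 => inord (nth q (code x ys) j)].
have difP x y : x < 2 ^ l -> y < 2 ^ l -> x != y ->
    dif x y < l /\ bit x (dif x y) != bit y (dif x y).
  move=> xl yl xy.
  have h : has (fun i => bit x i != bit y i) (iota 0 l).
    apply: contraNT xy => /hasPn h; apply/eqP/(bit_ext xl yl) => i il.
    by apply/eqP; have := h i; rewrite mem_iota negbK; apply.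
  have dl : dif x y < l by move: h; rewrite has_find size_iota.
  by split=> //; have := nth_find 0 h; rewrite nth_iota.
have LabP x ys b i : x < 2 ^ l -> all (ltn^~ (2 ^ l)) ys -> x \notin ys ->
    i \in Lab b x ys -> i < l /\ bit x i = b.
  move=> xl /allP ysl xys /mapP[y]; rewrite mem_filter => /andP[/eqP <- yys] ->.
  have xy : x != y by apply: contraNneq xys => ->.
  by have [] := difP x y xl (ysl y yys) xy.
have TP x ys : x < 2 ^ l -> size ys <= D -> all (ltn^~ (2 ^ l)) ys -> x \notin ys ->
    sep x ys (T x ys).
  move=> xl sys ysl xys; rewrite /T; case: pickP => //= none.
  have le_l i : i < l -> i < 2 ^ (k * d).
    move/leq_trans; apply; apply: leq_trans (up_logP l (isT : 1 < 2)) _.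
    by rewrite leq_exp2l // leq_pmull.
  have szL b : size (Lab b x ys) <= D.
    by rewrite size_map size_filter (leq_trans (count_size _ _)).
  have [||t] := @exists_sep_point k d f [seq (i, j) | i <- Lab false x ys, j <- Lab true x ys].
  - move=> _ /allpairsP[[i j] /= [/(LabP _ _ _ _ xl ysl xys)[il bi]
      /(LabP _ _ _ _ xl ysl xys)[jl bj] ->]] /=.
    by apply: agree; rewrite ?le_l //; apply: contra_eq_neq bi => ->; rewrite bj.
  - by rewrite size_allpairs (leq_ltn_trans _ Dk) // leq_mul2r leq_mul ?orbT.
  - by move=> h; have := none t; rewrite /sep h.
have code_le x ys j : nth q (code x ys) j < q.+1.
  have [jl|jl] := ltnP j (size (code x ys)); last by rewrite nth_default.
  have : all (ltn^~ q.+1) (code x ys).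
    rewrite /= ltnS ltnW //=; apply/allP => _ /mapP[i _ ->].
    by rewrite ltnS ltnW.
  by move/all_nthP => /(_ q _ jl).
pose F x ys : nat := enum_rank (col x ys).
(* It suffices to start from the end [x] with bit 0. Equal codes would place the hash of the label
   of [xy] among the hashes of [Out] of [y], although the label is in [In] of [y] and the hash point
   of [y] separates the two. *)
have ne x y xs ys : x < 2 ^ l -> y < 2 ^ l ->
    size xs <= D -> size ys <= D -> all (ltn^~ (2 ^ l)) xs -> all (ltn^~ (2 ^ l)) ys ->
    y \in xs -> x \in ys -> x \notin xs -> y \notin ys -> ~~ bit x (dif x y) ->
    F x xs <> F y ys.
  move=> xl yl sxs sys xsl ysl yxs xys nx ny bx /val_inj/enum_rank_inj/ffunP e.
  have nthE j : j <= D -> nth q (code x xs) j = nth q (code y ys) j.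
    move=> jD; have /(congr1 val) := e (Ordinal (jD : j < D.+1)).
    by rewrite !ffunE /= !inordK.
  have eT : T x xs = T y ys :> nat := nthE 0 isT.
  have xy : x != y by apply: contraNneq nx => ->.
  have [dl bxy] := difP x y xl yl xy.
  have iO : dif x y \in Lab false x xs by apply: map_f; rewrite mem_filter yxs (negPf bx).
  have iI : dif x y \in Lab true y ys.
    rewrite difC; apply: map_f; rewrite mem_filter xys difC andbT.
    by move: bxy bx; case: (bit x _); case: (bit y _).
  have fO : f (dif x y) (T x xs) \in [seq f i (T x xs) | i <- Lab false x xs] by exact: map_f.
  have pl := fO; rewrite -index_mem in pl.
  have sO : size (Lab false x xs) <= D by rewrite size_map size_filter (leq_trans (count_size _ _)).
  rewrite size_map in pl; have := nthE _ (leq_trans pl sO).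
  rewrite /= nth_index //.
  set j := index _ _ => fE.
  have [jl|jl] := ltnP j (size [seq f i (T y ys) | i <- Lab false y ys]); last first.
    by move: fE; rewrite [RHS]nth_default // => fE; have := fl (dif x y) (T x xs); rewrite fE ltnn.
  have /mapP[o oO oE] := mem_nth q jl.
  have /allP/(_ (o, dif x y)) := TP y ys yl sys ysl ny.
  rewrite allpairs_f //= => /(_ isT).
  by rewrite -oE -fE eT eqxx.
exists F; split.
  move=> x ys; apply: leq_trans (ltn_ord _) _.
  rewrite card_ffun !card_ord !addn1 (mulnC D.+1) expnM leq_exp2r //.
  by rewrite expnS mul2n -addnn -addn1 leq_add2l expn_gt0.
move=> x y xs ys xl yl sxs sys xsl ysl yxs xys nx ny.
have xy : x != y by apply: contraNneq nx => ->.
have [dl bxy] := difP x y xl yl xy.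
case bx: (bit x (dif x y)); last by apply/eqP/ne; rewrite ?bx.
rewrite eq_sym; apply/eqP/ne => //; rewrite difC.
by move: bxy; rewrite bx; case: (bit y _).
Qed.

(** * Iterating the reductions *)

Lemma all_ltn_trans a b s : a <= b -> all (ltn^~ a) s -> all (ltn^~ b) s.
Proof. by move=> ab; apply: sub_all => x /leq_trans; apply. Qed.

Lemma reduction_weaken D l1 l l' l2 F : l1 <= l -> l' <= l2 ->
  reduction D l l' F -> reduction D l1 l2 F.
Proof.
move=> h1 h2 [Flt ne].
have le1 : 2 ^ l1 <= 2 ^ l by rewrite leq_exp2l.
have le2 : 2 ^ l' <= 2 ^ l2 by rewrite leq_exp2l.
split=> [x ys|x y xs ys xl yl sx sy xsl ysl]; first exact: leq_trans (Flt _ _) le2.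
by apply: ne => //; [apply: leq_trans xl _|apply: leq_trans yl _
  |apply: all_ltn_trans xsl|apply: all_ltn_trans ysl].
Qed.

(* Colors sent along the chain have at most [s] bits. *)
Fixpoint reduction_chain D s l (Fs : seq (nat -> seq nat -> nat)) l' : Prop :=
  if Fs is F :: Fs' then
    l <= s /\ exists2 l1, reduction D l l1 F & reduction_chain D s l1 Fs' l'
  else l = l'.

Lemma reduction_chain_cat D s l l1 l2 Fs Gs :
  reduction_chain D s l Fs l1 -> reduction_chain D s l1 Gs l2 ->
  reduction_chain D s l (Fs ++ Gs) l2.
Proof.
elim: Fs l => [|F Fs IH] l /=; first by move=> ->.
by move=> [ls [l' redF ch]] ch'; split=> //; exists l' => //; apply: IH ch'.
Qed.

Lemma up_logM_leq x y : up_log 2 (x * y) <= up_log 2 x + up_log 2 y.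
Proof. by apply: up_log_min => //; rewrite expnD leq_mul // up_logP. Qed.

Lemma up_log_leq x : up_log 2 x <= x.
Proof. by apply: up_log_min => //; apply/ltnW/ltn_expl. Qed.

(** [y] follows the iterated logarithm and [2 ^ a] absorbs the factors in [D]. A round that would
    lengthen the colors is replaced by the identity, so colors never outgrow the initial message
    size. *)
Lemma sv_step D a l y : 0 < D -> 0 < y ->
  (D + 1) * (D * D * (a + 1) + 3) <= 2 ^ a -> l <= 2 ^ a * y ->
  exists2 l' : nat, exists F, reduction D l l' F &
    l' <= l /\ l' <= 2 ^ a * maxn 1 (up_log 2 (maxn 1 (up_log 2 y))).
Proof.
move=> D0 y0 ha ly; set y1 := maxn 1 (up_log 2 y); set y2 := maxn 1 _.
have y1_gt0 : 0 < y1 by rewrite leq_max.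
have y2_gt0 : 0 < y2 by rewrite leq_max.
pose k := up_log 2 (D * D * up_log 2 l + 1); pose l' := (D + 1) * (k + 1).
(* Colors out of range go to 0, since the bound on the new color must hold for all arguments. *)
have id_red : exists F, reduction D l l F.
  exists (fun x ys => if x < 2 ^ l then x else 0); split=> [x ys|].
    by case: ifP => //; rewrite expn_gt0.
  by move=> x y' xs ys -> -> _ _ _ _ yxs _ nx _; apply: contraNneq nx => ->.
have [l1|l1] := leqP l 1.
  by exists l => //; split=> //; rewrite (leq_trans l1) // muln_gt0 expn_gt0.
have ul0 : 0 < up_log 2 l by rewrite up_log_gt0.
have k0 : 0 < k by rewrite up_log_gt0 /= addn1 ltnS !muln_gt0 D0.
have red : exists F, reduction D l l' F.
  apply: sv_reduction => //; apply: leq_trans (up_logP _ (isT : 1 < 2)).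
  by rewrite addn1.
have l'le : l' <= 2 ^ a * y2.
  have h1 : up_log 2 l <= (a + 1) * y1.
    apply: leq_trans (leq_up_log _ ly) _; apply: leq_trans (up_logM_leq _ _) _.
    rewrite up_expnK //; have : up_log 2 y <= y1 by rewrite leq_max leqnn orbT.
    by move: y1_gt0; nia.
  have h2 : k <= up_log 2 (D * D * (a + 1) + 1) + y2.
    have h : D * D * up_log 2 l + 1 <= (D * D * (a + 1) + 1) * y1.
      by rewrite mulnDl mul1n leq_add // -!mulnA !leq_mul2l h1 !orbT.
    apply: leq_trans (leq_up_log _ h) _; apply: leq_trans (up_logM_leq _ _) _.
    by rewrite leq_add2l leq_max leqnn orbT.
  have h3 := up_log_leq (D * D * (a + 1) + 1).
  rewrite /l'; apply: leq_trans (_ : (D + 1) * (D * D * (a + 1) + 3) * y2 <= _); last first.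
    by rewrite leq_mul2r ha orbT.
  rewrite -[X in _ <= X]mulnA leq_mul2l; apply/orP; right.
  move: h2 h3 y2_gt0; set u := up_log 2 _; set v := D * D * (a + 1).
  by move=> *; nia.
have [le|lt] := leqP l' l; first by exists l'.
by exists l => //; split=> //; apply: leq_trans (ltnW lt) _.
Qed.

Lemma up_log_iter_log_star n j : log_star n <= j -> iter j (up_log 2) n <= 1.
Proof.
rewrite /log_star; case: ex_minnP => m hm _ /subnKC <-.
rewrite addnC iterD; elim: (j - m) => //= i IH.
by move: IH; case: (iter i _ _) => [|[|]] //; rewrite ?up_log0 ?up_log1.
Qed.

(** Each Szegedy-Vishwanathan round spends two logarithms, which halves [log_star n]; the last round
    is Linial's. The [+ 1] in [s] comes from [nat_of_bits w], which is only known to be below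
    [2 ^ (size w).+1]. *)
Lemma coloring_chain b D n : 0 < D -> D < n ->
  let s := b * up_log 2 n + 1 in
  exists2 Fs, size Fs = (log_star n)./2 + 1 &
    reduction_chain D s s Fs ((2 * b + 22) * up_log 2 D.+1).
Proof.
move=> D0 Dn s; set Lam := up_log 2 D.+1.
have Lam0 : 0 < Lam by rewrite up_log_gt0.
have DLam : D < 2 ^ Lam by apply: up_logP.
(* [3 * Lam] bits cover [D.+1 ^ 3], and the other [4 + 3 * Lam + b] cover the factor [a + 4]. The
   summand [b] also makes [2 ^ a] at least the factor [b + 1] of the initial length. *)
pose a := 6 * Lam + 4 + b.
have ha : (D + 1) * (D * D * (a + 1) + 3) <= 2 ^ a.
  apply: leq_trans (_ : (2 ^ Lam) ^ 3 * (a + 4) <= _).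
    apply: leq_trans (_ : D.+1 ^ 3 * (a + 4) <= _).
      by rewrite !expnS expn0; nia.
    by rewrite leq_mul2r leq_exp2r // DLam orbT.
  rewrite -expnM (_ : a = Lam * 3 + (4 + (3 * Lam + b))); last by rewrite /a; lia.
  rewrite [X in _ <= X]expnD leq_mul2l expnD; apply/orP; right.
  by have := ltn_expl (3 * Lam + b) (isT : 1 < 2); lia.
(* Bit lengths start one logarithm below [n], hence the odd number of iterations; at
   [t = (log_star n)./2] it is at least [log_star n]. *)
pose y t := maxn 1 (iter (2 * t).+1 (up_log 2) n).
have y0 t : 0 < y t by rewrite leq_max.
have yS t : y t.+1 = maxn 1 (up_log 2 (maxn 1 (up_log 2 (y t)))).
  have up_log_max x : up_log 2 (maxn 1 x) = up_log 2 x.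
    by case: x => [|x]; rewrite ?up_log0 ?up_log1 // (maxn_idPr (isT : 1 <= x.+1)).
  by rewrite !up_log_max /y mulnS !addSn.
have n1 : 0 < up_log 2 n by rewrite up_log_gt0; lia.
have chain t : exists l Fs, [/\ size Fs = t, reduction_chain D s s Fs l, l <= s & l <= 2 ^ a * y t].
  elim: t => [|t [l [Fs [szF ch ls ly]]]].
    exists s, [::]; split=> //; rewrite /s /y /= (maxn_idPr n1).
    apply: leq_trans (_ : (b + 1) * up_log 2 n <= _); first by nia.
    rewrite leq_mul2r /a expnD; apply/orP; right.
    have := ltn_expl b (isT : 1 < 2); have : 0 < 2 ^ (6 * Lam + 4) by rewrite expn_gt0.
    by nia.
  have [l' [F redF] [l'l l'y]] := sv_step D0 (y0 t) ha ly.
  exists l', (Fs ++ [:: F]); split; rewrite ?size_cat ?szF ?addn1 ?yS //.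
    by apply: reduction_chain_cat ch _; split=> //; exists l'.
  exact: leq_trans ls.
have [l [Fs [szF ch ls]]] := chain (log_star n)./2.
rewrite /y (maxn_idPl _) ?muln1 => [la|]; last first.
  by apply: up_log_iter_log_star; lia.
(* The final length is [2 * (Lam + a) = 14 * Lam + 8 + 2 * b], at most [(2 * b + 22) * Lam]. *)
have [F redF] : exists F, reduction D (2 ^ a) (2 * (Lam + a)) F.
  by apply: linial_reduction; rewrite ?expn_gt0 ?expnD ?ltn_mul2r ?expn_gt0 //; lia.
exists (Fs ++ [:: F]); first by rewrite size_cat szF.
apply: reduction_chain_cat ch _; split=> //.
exists ((2 * b + 22) * Lam) => //; apply: reduction_weaken redF => //.
by rewrite /a; nia.
Qed.

(** * Counting *)

(** Bernoulli's inequality for [(1 - 1/(w+1)) ^ i], cleared of denominators. *)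
Lemma bernoulli_nat w i : i <= w.+1 -> w.+1 ^ i * (w.+1 - i) <= w ^ i * w.+1.
Proof.
elim: i => [|i IH] iw; first by rewrite !expn0 subn0.
have {}IH := IH (ltnW iw).
rewrite !expnS; have [j wj] : exists j, w = i + j by exists (w - i); lia.
have [e1 e2] : w.+1 - i = j.+1 /\ w.+1 - i.+1 = j by lia.
rewrite e1 in IH; rewrite e2.
have h : w.+1 * j <= w * j.+1 by rewrite mulnS mulSn leq_add2r; lia.
have := leq_mul IH h; set a := w.+1 ^ i; set b := w ^ i => h'.
rewrite -(@leq_pmul2r j.+1) //; apply: leq_trans (_ : a * j.+1 * (w.+1 * j) <= _).
  by apply/eq_leq; ring.
by apply: leq_trans h' _; apply/eq_leq; ring.
Qed.

(** This is [(1 + 1/N) ^ N <= 4] for even [N]: Bernoulli bounds the power [N/2] by 2, and squaring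
    gives 4. *)
Lemma succ_expn_leq h : (h.*2).+1 ^ h.*2 <= 4 * h.*2 ^ h.*2.
Proof.
have e : (h.*2).+1 ^ h <= 2 * h.*2 ^ h.
  have := @bernoulli_nat h.*2 h; rewrite (_ : (h.*2).+1 - h = h.+1); last by lia.
  move=> /(_ ltac:(lia)); set a := _ ^ h; set b := _ ^ h => ab.
  rewrite -(@leq_pmul2r h.+1) //; apply: leq_trans ab _.
  by rewrite mulnAC mulnC leq_mul2r; apply/orP; right; lia.
have E x : x ^ h.*2 = x ^ h * x ^ h by rewrite -addnn expnD.
by rewrite !E; apply: leq_trans (leq_mul e e) _; apply/eq_leq; ring.
Qed.

Section Counting.
Variables (I X : finType).

(** Divided by powers of [N], this compares each factor [1 + a i / N] with [(1 + 1/N) ^ a i]. *)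
Lemma prod_addn_leq (a : I -> nat) N :
  \prod_i (N + a i) * N ^ (\sum_i a i) <= N ^ #|I| * N.+1 ^ (\sum_i a i).
Proof.
rewrite !expn_sum -prod_nat_const -!big_split /=.
apply: (big_ind2 (fun m n => m <= n)) => [|????|i _]; [by []|exact: leq_mul|].
elim: (a i) => [|m IH]; first by rewrite addn0.
rewrite !expnS; set u := N ^ m in IH *; set v := N.+1 ^ m in IH *.
apply: leq_trans (_ : (N + m) * u * N.+1 <= _); first by nia.
by apply: leq_trans (leq_mul IH (leqnn _)) _; apply/eq_leq; ring.
Qed.

(* Exponential Markov inequality: compare with the sum of [2 ^ hits] over all [g]. *)
Lemma card_many_hits (Z : I -> {set X}) t u :
  0 < #|X| -> ~~ odd #|X| -> \sum_i #|Z i| <= #|X| * u ->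
  #|[set g : {ffun I -> X} | t <= #|[set i | g i \in Z i]|]| * 2 ^ t
    <= #|X| ^ #|I| * 4 ^ u.
Proof.
move=> X0 evX Zu; set N := #|X| in X0 evX Zu *.
(* [2 ^ hits] is a product over the coordinates, so its sum over all [g] factors. *)
have sumE : \sum_(g : {ffun I -> X}) 2 ^ #|[set i | g i \in Z i]| = \prod_i (N + #|Z i|).
  transitivity (\sum_(g : {ffun I -> X}) \prod_i (2 ^ (g i \in Z i))).
    apply: eq_bigr => g _; rewrite -expn_sum -sum1_card; congr (2 ^ _).
    by rewrite [RHS](bigID (fun i => g i \in Z i)) /= [X in _ = _ + X]big1 => [|i /negPf->//];
       rewrite addn0; apply: eq_big => i; rewrite ?inE // => ->.
  rewrite -(bigA_distr_bigA (fun i x => 2 ^ (x \in Z i))); apply: eq_bigr => i _.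
  rewrite /N -[#|X|]sum1_card -[#|Z i|]sum1_card [X in _ = _ + X]big_mkcond -big_split /=.
  by apply: eq_bigr => x _; case: (x \in Z i).
apply: leq_trans (_ : \prod_i (N + #|Z i|) <= _).
  rewrite -sumE -sum_nat_const; set P := [set g | _].
  rewrite [leqRHS](bigID (mem P)) /=; apply: leq_trans (leq_addr _ _).
  by apply: leq_sum => g; rewrite inE => h; rewrite leq_exp2l.
have Nu : N.+1 ^ (N * u) <= 4 ^ u * N ^ (N * u).
  rewrite !expnM -expnMn; case: u {Zu} => [|u]; first by rewrite !expn0.
  rewrite leq_exp2r // -(odd_double_half N) (negPf evX) add0n; exact: succ_expn_leq.
rewrite -(@leq_pmul2r (N ^ (N * u))) ?expn_gt0 ?X0 // -mulnA.
apply: leq_trans (leq_mul (leqnn _) Nu).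
rewrite -(subnKC Zu) !expnD !mulnA; apply: leq_mul; first exact: prod_addn_leq.
by case: (_ - _) => // m; rewrite leq_exp2r.
Qed.
End Counting.

(* Averaging over all assignments. *)
Lemma exists_assignment (T F : finType) (bad : T -> T -> F -> F -> bool) :
  0 < #|F| ->
  (forall A B, A != B -> forall fB, #|[set f | bad A B f fB]| * #|T| ^ 2 < #|F|) ->
  exists K : {ffun T -> F}, forall A B, A != B -> ~~ bad A B (K A) (K B).
Proof.
move=> F0 few.
pose badK A B := [set K : {ffun T -> F} | bad A B (K A) (K B)].
have [T0|T0] := posnP #|T|.
  have [f _] : exists f : F, true by move/card_gt0P: F0 => [f]; exists f.
  by exists [ffun=> f] => A; have := max_card (pred1 A); rewrite card1 T0.
pose N := #|{ffun T -> F}|.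
have N0 : 0 < N by rewrite /N card_ffun expn_gt0 F0.
have cardK A B : A != B -> #|badK A B| * #|T| ^ 2 < N.
  move=> AB.
  (* Exchanging [K A] with a fresh independent value is a bijection; it turns the bad event into one
     about the fresh value and the unchanged [K B], to which [few] applies. *)
  pose phi (p : {ffun T -> F} * F) := ([ffun x => if x == A then p.2 else p.1 x], p.1 A).
  have phiK : involutive phi.
    move=> [K f]; rewrite /phi /=; congr (_, _); last by rewrite ffunE eqxx.
    by apply/ffunP => x; rewrite !ffunE; case: eqP => // ->.
  have e : #|badK A B| * #|F| = \sum_(K : {ffun T -> F}) #|[set f | bad A B f (K B)]|.
    transitivity (\sum_(p : {ffun T -> F} * F) (bad A B (p.1 A) (p.1 B) : nat)).
      rewrite -(pair_bigA _ (fun (K : {ffun T -> F}) (f : F) => bad A B (K A) (K B) : nat)) /=.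
      rewrite -sum_nat_const big_mkcond /=; apply: eq_bigr => K _.
      by rewrite sum_nat_const inE; case: (bad _ _ _ _); rewrite ?muln1 ?muln0.
    rewrite (reindex_inj (inv_inj phiK)) /=.
    rewrite (eq_bigr (fun p : {ffun T -> F} * F => bad A B p.2 (p.1 B) : nat)); last first.
      by move=> p _; rewrite !ffunE eqxx eq_sym (negPf AB).
    rewrite -(pair_bigA _ (fun (K : {ffun T -> F}) (f : F) => bad A B f (K B) : nat)) /=.
    apply: eq_bigr => K _; rewrite -sum1_card [RHS]big_mkcond /=.
    by apply: eq_bigr => f _; rewrite inE; case: (bad _ _ _ _).
  rewrite -(@ltn_pmul2r #|F|) // mulnAC e big_distrl /=.
  have lef K : #|[set f | bad A B f (K B)]| * #|T| ^ 2 <= #|F|.-1.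
    by have := few A B AB (K B); lia.
  apply: (@leq_ltn_trans (\sum_(K : {ffun T -> F}) #|F|.-1)).
    by apply: leq_sum => K _; apply: lef.
  by rewrite sum_nat_const ltn_pmul2l // prednK.
(* Union bound over the ordered pairs of elements of [T]. *)
have [K] : exists K : {ffun T -> F},
    all (fun p : T * T => ~~ ((p.1 != p.2) && bad p.1 p.2 (K p.1) (K p.2))) (enum {: T * T}).
  have N1 : N.-1 %/ #|T| ^ 2 * #|T| ^ 2 < N.
    by have := leq_divM N.-1 (#|T| ^ 2); lia.
  apply: (exists_avoiding (d := N.-1 %/ #|T| ^ 2)) => [[A B] _ /=|]; last first.
    by rewrite -cardE card_prod mulnC -[#|T| * _]/(#|T| ^ 2).
  rewrite leq_divRL ?expn_gt0 ?T0 //; have [->|AB] := eqVneq A B.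
    by rewrite (_ : [set _ | _] = set0) ?cards0 //; apply/setP => K; rewrite !inE.
  by have := cardK A B AB; rewrite /badK /=; lia.
move=> /allP h; exists K => A B AB; have := h (A, B); rewrite mem_enum /= AB; exact.
Qed.

(** * List coloring against few neighbors *)

(* A node of color [x] that has broadcast the list [S] restricts itself to
   [dec x S i], where the index [i = idx x S ps] depends only on the colors and
   lists [ps] of the at most [beta] neighbors it must avoid, not on the indices
   they choose. *)
Definition list_gadget (C : finType) M beta l r
    (dec : nat -> {set C} -> nat -> {set C})
    (idx : nat -> {set C} -> seq (nat * {set C}) -> nat) :=
  (forall x (S : {set C}) i, dec x S i \subset S) /\
  forall x (S : {set C}) (ps : seq (nat * {set C})), x < M -> #|S| = l -> size ps <= beta ->
    all (fun p : nat * {set C} => [&& p.1 < M, p.1 != x & #|p.2| == l]) ps ->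
    idx x S ps < r /\
    forall qs : seq (nat * {set C} * nat), [seq q.1 | q <- qs] = ps ->
      exists2 c, c \in dec x S (idx x S ps) & forall q, q \in qs -> c \notin dec q.1.1 q.1.2 q.2.

(** With no neighbor to avoid, one color is enough and nothing has to be chosen. *)
Lemma list_gadget0 (C : finType) M : exists dec idx, @list_gadget C M 0 1 1 dec idx.
Proof.
exists (fun _ S _ => S), (fun _ _ _ => 0); split=> // x S [|? ?] // _ S1 _ _; split=> // -[|? ?] // _.
have /card_gt0P[c cS] : 0 < #|S| by rewrite S1.
by exists c.
Qed.

(** * Probabilistic construction of the gadget *)

Section Gadget.
Variables (C : finType) (c0 : C) (M beta lam s : nat).
Hypotheses (M_gt0 : 0 < M) (beta_gt0 : 0 < beta) (lam_gt0 : 0 < lam) (s_gt0 : 0 < s).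
Let w := 4 * beta.
Let k := w * lam.
Let r := beta * s.
Hypothesis r_le : r <= 2 ^ lam.
Hypothesis s_le : 4 * (M * #|C| ^ (k * w)) ^ 2 < 2 ^ s.

(** An element of [T] is a color with a list arranged in [k] blocks of [w] colors. An element of [G]
    picks one color from each block, and one of [F] is a family of [r] such candidate sets. *)
Let T : finType := ('I_M * {ffun 'I_k * 'I_w -> C})%type.
Let G : finType := {ffun 'I_k -> 'I_w}.
Let F : finType := {ffun 'I_r -> G}.

Let cset (A : T) (g : G) : {set C} := [set A.2 (j, g j) | j : 'I_k].
Let hits (A : T) (g : G) (S : {set C}) := #|[set j | A.2 (j, g j) \in S]|.
Let hit_set (A B : T) (fB : F) : {set G} :=
  [set g | [exists i, 4 * lam <= hits A g (cset B (fB i))]].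
(** [B] spoils a candidate of [A] if some candidate of [B] meets it in at least [4 * lam] blocks.
    Injectivity singles out the arrangements of genuine lists of full length. *)
Let bad (A B : T) (fA fB : F) :=
  injectiveb A.2 && (s <= #|[set i | fA i \in hit_set A B fB]|).

Let cardG : #|G| = w ^ k.
Proof. by rewrite card_ffun !card_ord. Qed.
Let w_gt0 : 0 < w. Proof. by rewrite muln_gt0. Qed.
Let k_gt0 : 0 < k. Proof. by rewrite muln_gt0 w_gt0. Qed.

(** [S] occupies at most [k = w * lam] cells, so a random candidate meets it in at most [lam] blocks
    on average; meeting it in [4 * lam] blocks has probability at most [4 ^ lam / 2 ^ (4 * lam)]. *)
Let card_hits (A : T) (S : {set C}) : injective A.2 -> #|S| <= k ->
  #|[set g | 4 * lam <= hits A g S]| * 4 ^ lam <= w ^ k.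
Proof.
move=> injA Sk; pose Z j := [set x | A.2 (j, x) \in S].
have sZ : \sum_j #|Z j| <= #|'I_w| * lam.
  rewrite card_ord; apply: leq_trans Sk.
  have -> : \sum_j #|Z j| = #|[set p | A.2 p \in S]|.
    transitivity (\sum_j \sum_(x : 'I_w) (A.2 (j, x) \in S : nat)).
      apply: eq_bigr => j _; rewrite -sum1_card big_mkcond /=.
      by apply: eq_bigr => x _; rewrite inE; case: (_ \in S).
    rewrite (pair_bigA _ (fun j x => A.2 (j, x) \in S : nat)) /= -sum1_card [RHS]big_mkcond /=.
    by apply: eq_bigr => -[j x] _; rewrite inE; case: (_ \in S).
  rewrite -(card_imset _ injA); apply/subset_leq_card/subsetP => _ /imsetP[p + ->].
  by rewrite inE.
have := @card_many_hits 'I_k 'I_w Z (4 * lam) lam.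
rewrite card_ord w_gt0 oddM => /(_ isT isT); rewrite card_ord in sZ; move=> /(_ sZ).
rewrite card_ord (_ : 2 ^ (4 * lam) = 4 ^ lam * 4 ^ lam); last first.
  by rewrite -expnMn -(expnM 2 4).
rewrite mulnA leq_pmul2r ?expn_gt0 //; apply: leq_trans; rewrite leq_mul2r.
apply/orP; right; apply/eq_leq/eq_card => g; rewrite !inE /hits.
by congr (_ <= _); apply: eq_card => j; rewrite !inE.
Qed.

(** By a union bound over the family of [B], a random candidate of [A] is spoilt with probability at
    most [r / 4 ^ lam <= 1 / r]. On average at most one of the [r] candidates is spoilt, so [s] of
    them are with probability at most [4 / 2 ^ s]. *)
Let card_bad (A B : T) (fB : F) : #|[set f | bad A B f fB]| * #|T| ^ 2 < #|F|.
Proof.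
have F0 : 0 < #|F| by rewrite !card_ffun !card_ord !expn_gt0 w_gt0.
case: (altP (injectiveP A.2)) => [injA|ninjA]; last first.
  by rewrite (_ : [set _ | _] = set0) ?cards0 //; apply/setP => f; rewrite !inE /bad (negPf ninjA).
have cardT : #|T| = M * #|C| ^ (k * w) by rewrite card_prod card_ffun card_prod !card_ord.
have csetk g : #|cset B g| <= k by rewrite (leq_trans (leq_imset_card _ _)) ?card_ord.
have sH : #|hit_set A B fB| * 4 ^ lam <= r * w ^ k.
  apply: leq_trans (_ : (\sum_(i < r) #|[set g | 4 * lam <= hits A g (cset B (fB i))]|) * 4 ^ lam <= _).
    rewrite leq_mul2r; apply/orP; right.
    have : hit_set A B fB \subset \bigcup_i [set g | 4 * lam <= hits A g (cset B (fB i))].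
      by apply/subsetP => g; rewrite inE => /existsP[i hi]; apply/bigcupP; exists i; rewrite ?inE.
    move/subset_leq_card/leq_trans; apply.
    elim/big_ind2: _ => [|m1 S1 m2 S2 h1 h2|//]; first by rewrite cards0.
    by rewrite (leq_trans (leq_card_setU _ _)) ?leq_add.
  rewrite big_distrl /=; apply: leq_trans (_ : \sum_(i < r) w ^ k <= _).
    by apply: leq_sum => i _; apply: card_hits.
  by rewrite sum_nat_const card_ord.
have := @card_many_hits 'I_r G (fun=> hit_set A B fB) s 1.
have G0 : 0 < #|G| by rewrite cardG expn_gt0 w_gt0.
have evG : ~~ odd #|G| by rewrite cardG oddX oddM /= orbF -lt0n k_gt0.
have sum_le : \sum_(i < r) #|hit_set A B fB| <= #|G| * 1.
  rewrite sum_nat_const card_ord muln1 cardG -(@leq_pmul2r (4 ^ lam)) ?expn_gt0 //.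
  rewrite -mulnA; apply: leq_trans (leq_mul (leqnn r) sH) _; rewrite mulnA mulnC leq_mul2l.
  by rewrite (_ : 4 ^ lam = 2 ^ lam * 2 ^ lam) ?leq_mul ?orbT // -expnMn.
move=> /(_ G0 evG sum_le); rewrite card_ord expn1 (_ : #|G| ^ r = #|F|); last first.
  by rewrite [#|F|]card_ffun card_ord.
rewrite cardT (_ : [set f | bad A B f fB] = [set g : F | s <= #|[set i | g i \in hit_set A B fB]|]).
  by move: s_le F0; set x := _ ^ 2; set y := 2 ^ s; set z := #|[set _ | _]|; nia.
apply/setP => f; rewrite !inE /bad; apply: andb_idl => _; exact/injectiveP.
Qed.

(** Each neighbor spoils fewer than [s] of the [beta * s] candidates, so some candidate is spoilt by
    none. Whatever their indices, the neighbors then meet it in fewer than [4 * lam] blocks each,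
    and one of the [k = 4 * beta * lam] blocks stays free. *)
Lemma list_gadget_pos : exists dec idx, @list_gadget C M beta (k * w) r dec idx.
Proof.
have F0 : 0 < #|F| by rewrite !card_ffun !card_ord !expn_gt0 w_gt0.
have [K goodK] := exists_assignment F0 (fun A B _ => @card_bad A B).
pose ty x S : T := (insubd (Ordinal M_gt0) x,
  [ffun p : 'I_k * 'I_w => nth c0 (enum (S : {set C})) (p.1 * w + p.2)]).
pose dec x (S : {set C}) i : {set C} :=
  if insub i is Some i' then S :&: cset (ty x S) (K (ty x S) i') else set0.
have r_gt0 : 0 < r by rewrite muln_gt0 beta_gt0.
pose ok x S (ps : seq (nat * {set C})) (i : 'I_r) :=
  all (fun p => K (ty x S) i \notin hit_set (ty x S) (ty p.1 p.2) (K (ty p.1 p.2))) ps.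
exists dec, (fun x S ps => odflt (Ordinal r_gt0) [pick i | ok x S ps i]).
split=> [x S i|x S ps xM Sl sps psP].
  by rewrite /dec; case: insub => [i'|]; rewrite ?subsetIl ?sub0set.
have idx_lt (p : 'I_k * 'I_w) : p.1 * w + p.2 < k * w.
  by case: p => [[j jk] [y yw]] /=; nia.
have injS (S' : {set C}) : #|S'| = k * w -> injective (ty x S').2.
  move=> S'l [j y] [j' y']; rewrite !ffunE /= => /eqP; rewrite nth_uniq ?enum_uniq //; last 2 first.
  - by rewrite -cardE S'l; apply: (idx_lt (j, y)).
  - by rewrite -cardE S'l; apply: (idx_lt (j', y')).
  move/eqP => e; have ej : j = j' :> nat.
    by have := congr1 (divn^~ w) e; rewrite !divnMDl // !divn_small // !addn0.
  by move: e; rewrite ej => /addnI ey; congr (_, _); apply: val_inj.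
have [i0 ok0] : exists i, ok x S ps i.
  apply: (exists_avoiding (P := fun (p : nat * {set C}) (i : 'I_r) => K (ty x S) i \in
    hit_set (ty x S) (ty p.1 p.2) (K (ty p.1 p.2))) (d := s.-1)) => [[x' S'] /= pin|]; last first.
    rewrite card_ord; apply: leq_ltn_trans (leq_mul sps (leqnn _)) _.
    by rewrite ltn_pmul2l // prednK.
  have /and3P[/= x'M x'x _] := allP psP _ pin.
  have /goodK : ty x S != ty x' S'.
    apply: contraNneq x'x => -[/(congr1 val) + _]; rewrite !val_insubd x'M xM => e.
    by rewrite e.
  by rewrite /bad (introT (injectiveP _) (injS S Sl)) /= -ltnNge; move: s_gt0; case: s.
case: pickP => [i avoid /=|/(_ i0)]; last by rewrite ok0.
split=> // qs qsE.
have [j /allP avj] : exists j : 'I_k,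
    all (fun q : nat * {set C} * nat => ~~ ((ty x S).2 (j, K (ty x S) i j) \in dec q.1.1 q.1.2 q.2)) qs.
  apply: (exists_avoiding (P := fun (q : nat * {set C} * nat) (j : 'I_k) =>
    (ty x S).2 (j, K (ty x S) i j) \in dec q.1.1 q.1.2 q.2) (d := 4 * lam - 1)) => [q qin|]; last first.
    rewrite card_ord -(size_map fst) qsE /k /w.
    apply: leq_ltn_trans (leq_mul sps (leqnn _)) _.
    by rewrite [X in _ < X]mulnAC mulnC ltn_pmul2r // subn1 prednK // muln_gt0.
  have := allP avoid q.1; rewrite -qsE map_f // => /(_ isT).
  rewrite inE negb_exists => /forallP notbad.
  rewrite /dec; case: insub => [i'|]; last first.
    by rewrite (_ : [set _ | _] = set0) ?cards0 //; apply/setP => j; rewrite !inE.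
  have := notbad i'; rewrite -ltnNge /hits => lt.
  rewrite -ltnS subn1 prednK ?muln_gt0 //; apply: leq_ltn_trans lt.
  by apply/subset_leq_card/subsetP => j; rewrite !inE => /andP[].
exists ((ty x S).2 (j, K (ty x S) i j)) => //.
rewrite /dec valK inE; apply/andP; split; last by apply/imsetP; exists j.
by rewrite ffunE -mem_enum mem_nth // -cardE Sl; apply: (idx_lt (j, _)).
Qed.
End Gadget.

Lemma list_gadget_exists (C : finType) M beta lam s :
  0 < M -> 0 < beta -> 0 < lam -> 0 < s -> beta * s <= 2 ^ lam ->
  4 * (M * #|C| ^ (16 * beta ^ 2 * lam)) ^ 2 < 2 ^ s ->
  exists dec idx, @list_gadget C M beta (16 * beta ^ 2 * lam) (beta * s) dec idx.
Proof.
move=> M0 b0 lam0 s0 rle; have -> : 16 * beta ^ 2 * lam = 4 * beta * lam * (4 * beta).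
  by rewrite -mulnn; nia.
case: (pickP [pred c : C | true]) => [c0 _|noC] sle; first exact: list_gadget_pos.
(* Without colors no list has the required positive length. *)
exists (fun _ _ _ => set0), (fun _ _ _ => 0); split=> [*|x S ps _ Sl]; first exact: sub0set.
have := leq_trans (max_card S) (eq_leq (eq_card0 noC)); rewrite Sl.
by nia.
Qed.

(** * Programs *)

(* [clr] is the color in the initial coloring, [cls] the class of the node and the
   round at which it joined it, and [inbox] lists by port the messages received
   recently. *)
Record node (C : finType) := Node {
  lst : {set C};
  clr : nat;
  cls : option (nat * nat);
  inbox : seq (seq (message C));
  out_col : option C
}.

Record step (C : finType) := Step {
  smsg : node C -> message C;
  supd : node C -> seq (message C) -> node C
}.

Definition nat_msg {C : finType} (x : nat) : message C := Bits C (bits_of_nat x).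
Definition msg_nat {C : finType} (m : message C) : nat :=
  if m is Bits w then nat_of_bits w else 0.

Arguments nat_msg {C} x : simpl never.
Arguments msg_nat {C} m : simpl never.

Lemma nat_msgK (C : finType) : cancel (@nat_msg C) (@msg_nat C).
Proof. exact: bits_of_natK. Qed.

Definition small {C : finType} s (m : message C) : bool :=
  if m is Bits w then size w <= s else false.

Arguments small {C} s m : simpl never.

Lemma small_nat_msg (C : finType) s x : x < 2 ^ s -> small s (@nat_msg C x).
Proof. exact: size_bits_of_nat. Qed.

Definition init_node (C : finType) (w : bitseq) (S : {set C}) : node C :=
  Node S (nat_of_bits w) None [::] None.

(** The state carries the remaining program, which serves as the round counter. *)
Definition prog_alg (C : finType) (p : seq (step C)) :
    local_alg {set C} (message C) C :=
  LocalAlg (state := (seq (step C) * node C)%type)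
    (fun _ w S => (p, init_node w S))
    (fun s _ => if s.1 is st :: _ then smsg st s.2 else Bits C [::])
    (fun s ms => if s.1 is st :: p' then (p', supd st s.2 ms) else s)
    (fun s => out_col s.2).

Section Exec.
Variables (C : finType) (G : graph) (N : network G).
Implicit Types (sg : G -> node C) (p : seq (step C)) (st : step C).

Definition exec_step st sg : G -> node C :=
  fun v => supd st (sg v) [seq smsg st (sg u) | u <- ports N v].

Definition exec p sg := foldl (fun sg st => exec_step st sg) sg p.

Lemma exec_cat p1 p2 sg : exec (p1 ++ p2) sg = exec p2 (exec p1 sg).
Proof. exact: foldl_cat. Qed.

Lemma exec_rcons p st sg : exec (rcons p st) sg = exec_step st (exec p sg).
Proof. exact: foldl_rcons. Qed.

Fixpoint msgs p sg v : seq (message C) :=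
  if p is st :: p' then smsg st (sg v) :: msgs p' (exec_step st sg) v else [::].

Lemma msgs_cat p1 p2 sg v : msgs (p1 ++ p2) sg v = msgs p1 sg v ++ msgs p2 (exec p1 sg) v.
Proof. by elim: p1 sg => //= st p1 IH sg; rewrite IH. Qed.

Lemma size_msgs p sg v : size (msgs p sg v) = size p.
Proof. by elim: p sg => //= st p IH sg; rewrite IH. Qed.

Definition once s (S : {set C}) (ms : seq (message C)) : Prop :=
  exists a b (S' : {set C}), [/\ ms = a ++ ColorSet S' :: b, S' \subset S, all (small s) a & all (small s) b].

(** The form is stable under concatenation: a node that spends its broadcast ends up colored, and a
    colored node sends only short messages from then on. *)
Definition thrifty s (L : G -> {set C}) p sg : Prop := forall v,
  (isSome (out_col (sg v)) -> all (small s) (msgs p sg v) /\ isSome (out_col (exec p sg v))) /\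
  (all (small s) (msgs p sg v) \/
   isSome (out_col (exec p sg v)) /\ once s (L v) (msgs p sg v)).

Lemma thrifty_cat s L p1 p2 sg :
  thrifty s L p1 sg -> thrifty s L p2 (exec p1 sg) -> thrifty s L (p1 ++ p2) sg.
Proof.
move=> h1 h2 v; have [d1 o1] := h1 v; have [d2 o2] := h2 v.
rewrite msgs_cat exec_cat all_cat; split=> [/d1[-> /d2[-> ->]]|] //.
case: o1 => [s1|[/d2[s2 c2] [a [b [S [e SL sa sb]]]]]]; last first.
  right; split=> //; exists a, (b ++ msgs p2 (exec p1 sg) v), S.
  by rewrite e -catA all_cat sb s2.
case: o2 => [s2|[c2 [a [b [S [e SL sa sb]]]]]]; first by left; rewrite s1 s2.
right; split=> //; exists (msgs p1 sg v ++ a), b, S.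
by rewrite e catA all_cat s1 sa.
Qed.

Lemma thrifty_nil s L sg : thrifty s L [::] sg.
Proof. by move=> v; split=> //; left. Qed.

Definition sg0 (L : G -> {set C}) : G -> node C := fun v => init_node (node_id N v) (L v).

Lemma run_prog p (L : G -> {set C}) t v : t <= size p ->
  run (prog_alg p) N L t v = (drop t p, exec (take t p) (sg0 L) v).
Proof.
elim: t v => [|t IH] v tp; first by rewrite drop0 take0.
have E u := IH u (ltnW tp).
have [st0 _] : exists st0 : step C, true by case: p tp {IH E} => // st0; exists st0.
rewrite [LHS]/= E /= (drop_nth st0) // (take_nth st0) // exec_rcons; congr (_, _).
by congr (supd _ _ _); apply: eq_map => u; rewrite E (drop_nth st0).
Qed.

Lemma sent_prog p (L : G -> {set C}) t v w : t < size p ->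
  sent (prog_alg p) N L t v w = nth (Bits C [::]) (msgs p (sg0 L) v) t.
Proof.
move=> tp; rewrite /sent run_prog 1?ltnW //=.
case: p tp => // st0 p; set q := st0 :: p => tp.
rewrite (drop_nth st0) //; move: (sg0 L) => sg; elim: t q sg tp => [|t IH] [|st q] //= sg tp.
by rewrite IH.
Qed.

Lemma thrifty_broadcast s L p v :
  thrifty s L p (sg0 L) -> single_list_broadcast (prog_alg p) N L (size p) s v.
Proof.
move=> /(_ v)[_ []].
  (* The broadcast round is placed after the end of the execution. *)
  move/all_nthP => sm; exists (size p), set0; split=> [|t w tp _]; first exact: sub0set.
  rewrite (ltn_eqF tp) sent_prog //.
  by have := sm (Bits C [::]) t; rewrite size_msgs => /(_ tp); case: (nth _ _ _).
move=> [_ [a [b [S [e SL sa sb]]]]]; exists (size a), S; split=> // t w tp _.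
rewrite sent_prog // e nth_cat; have := tp; rewrite -(size_msgs p (sg0 L) v) e size_cat /= => tl.
case: ltngtP => ta.
- by have := all_nthP (Bits C [::]) sa t ta; case: (nth _ _ _).
- have -> : t - size a = (t - (size a).+1).+1 by lia.
  have := all_nthP (Bits C [::]) sb (t - (size a).+1).
  by rewrite /=; case: (nth _ _ _) => [w0|S0] /(_ ltac:(lia)).
- by rewrite ta subnn.
Qed.

Lemma count_ports (P : pred G) v : count P (ports N v) = #|[set u | adj v u & P u]|.
Proof.
rewrite -size_filter -(card_uniqP (filter_uniq P (ports_uniq N v))).
by apply: eq_card => u; rewrite !inE mem_filter mem_ports andbC.
Qed.

Lemma size_ports v : size (ports N v) = deg v.
Proof. by rewrite -count_predT count_ports; apply: eq_card => u; rewrite !inE andbT. Qed.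
End Exec.

(** * Splitting the nodes into classes *)

Definition set_cls (C : finType) (s : node C) o : node C :=
  Node (lst s) (clr s) o [::] (out_col s).

Definition reset_step (C : finType) : step C :=
  Step (fun=> nat_msg 0) (fun s _ => set_cls s None).

Definition value (C : finType) (f : nat -> nat -> nat) t (s : node C) : nat :=
  if cls s is Some (y, _) then y else f (clr s) t.

(** Colored nodes announce 0, so values are shifted by one. *)
Definition class_step (C : finType) f beta t : step C :=
  Step (fun s => if out_col s is Some _ then nat_msg 0 else nat_msg (value f t s).+1)
    (fun s ms => if (cls s == None) && (count (fun m => msg_nat m == (value f t s).+1) ms <= beta)
                 then set_cls s (Some (value f t s, t)) else s).

Definition classes (C : finType) f beta q : seq (step C) :=
  reset_step C :: [seq class_step C f beta t | t <- iota 0 q].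

(* Nodes that join a class in the same round avoid each other. *)
Definition avoids (C : finType) (sv su : node C) : bool :=
  match cls sv, cls su with
  | Some (y, t), Some (y', t') => (y' == y) && (t' <= t)
  | _, _ => false
  end.

Definition uncol (C : finType) (s : node C) : bool := ~~ isSome (out_col s).

Definition same_coloring (C : finType) (G : graph) (sg sg' : G -> node C) :=
  forall v, [/\ lst (sg' v) = lst (sg v), clr (sg' v) = clr (sg v) & out_col (sg' v) = out_col (sg v)].

Section Classes.
Variables (C : finType) (G : graph) (N : network G).
Variables (f : nat -> nat -> nat) (M k d beta Delta : nat).
Let q := 2 ^ k.
Hypothesis f_lt : forall x t, f x t < q.
Hypothesis f_agree : forall x y, x < M -> y < M -> x != y ->
  #|[set t : 'I_q | f x t == f y t]| <= d.
Hypothesis f_const : forall x b, #|[set t : 'I_q | f x t == b]| <= d.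
Hypothesis q_large : 2 * d * Delta < q * (beta + 1).
Implicit Types sg : G -> node C.

(** The value announced in the past round [t], reconstructed from the current class. *)
Let hist (s : node C) t : nat :=
  if cls s is Some (y, t') then (if t <= t' then f (clr s) t else y) else f (clr s) t.

(** The middle clause records that each past round in which a node failed to settle cost it at least
    [beta + 1] collisions. *)
Let Inv t sg : Prop := forall v,
  [/\ forall y t', cls (sg v) = Some (y, t') -> t' < t /\ y < q,
      uncol (sg v) -> cls (sg v) = None ->
        t * (beta + 1) <= \sum_(u | adj v u && uncol (sg u))
          \sum_(t' < t) (hist (sg u) t' == f (clr (sg v)) t' : nat)
    & uncol (sg v) -> #|[set u | adj v u & uncol (sg u) && avoids (sg v) (sg u)]| <= beta].

Let matches t sg v := #|[set u | adj v u & uncol (sg u) && (value f t (sg u) == value f t (sg v))]|.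

Let class_stepE t sg v : exec_step N (class_step C f beta t) sg v =
  if (cls (sg v) == None) && (matches t sg v <= beta)
  then set_cls (sg v) (Some (value f t (sg v), t)) else sg v.
Proof.
rewrite /exec_step /= count_map count_ports.
suff -> : [set u | adj v u & preim (fun u => if out_col (sg u) is Some _ then nat_msg 0
    else nat_msg (value f t (sg u)).+1) (fun m : message C => msg_nat m == (value f t (sg v)).+1) u]
  = [set u | adj v u & uncol (sg u) && (value f t (sg u) == value f t (sg v))] by [].
by apply/setP => u; rewrite !inE /uncol; case: (out_col (sg u)) => [c|] /=; rewrite nat_msgK ?andbF.
Qed.

Let class_step_same t sg : same_coloring sg (exec_step N (class_step C f beta t) sg).
Proof. by move=> v; rewrite class_stepE; case: ifP. Qed.

Let Inv_step t sg : t < q -> Inv t sg -> Inv t.+1 (exec_step N (class_step C f beta t) sg).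
Proof.
move=> tq inv; set sg' := exec_step _ _ _.
have same := class_step_same t sg; rewrite -/sg' in same.
have uncE u : uncol (sg' u) = uncol (sg u) by rewrite /uncol; have [_ _ ->] := same u.
have clrE u : clr (sg' u) = clr (sg u) by have [_ -> _] := same u.
have value_lt u : value f t (sg u) < q.
  by rewrite /value; case e: (cls (sg u)) => [[y t']|] //; have [/(_ _ _ e)[]] := inv u.
have clsE u : cls (sg' u) = if (cls (sg u) == None) && (matches t sg u <= beta)
    then Some (value f t (sg u), t) else cls (sg u).
  by rewrite /sg' class_stepE; case: ifP.
have histE u t' : t' < t -> hist (sg' u) t' = hist (sg u) t'.
  move=> tt; rewrite /hist clsE clrE; case: ifP => // /andP[/eqP-> _].
  by rewrite ltnW.
have hist_t u : hist (sg' u) t = value f t (sg u).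
  rewrite /hist clsE clrE /value; case e: (cls (sg u)) => [[y t']|] /=.
    by have [/(_ _ _ e)[tt _] _ _] := inv u; rewrite leqNgt tt.
  by case: ifP; rewrite ?leqnn.
move=> v; have [inv1 inv2 inv3] := inv v; split.
- move=> y t'; rewrite clsE; case: ifP => [_ [<- <-]|_ /inv1[tt ?]]; first by rewrite value_lt.
  by rewrite ltnS ltnW.
- rewrite uncE clsE => uv; case: ifP => // /negbT; rewrite negb_and => h nv.
  move: h; rewrite nv /= -ltnNge => many; have {}inv2 := inv2 uv nv.
  rewrite mulSn addnC (eq_bigl (fun u => adj v u && uncol (sg u))) => [|u]; last by rewrite uncE.
  rewrite (eq_bigr (fun u => \sum_(t' < t) (hist (sg u) t' == f (clr (sg v)) t' : nat)
      + (value f t (sg u) == value f t (sg v)))) => [|u _]; last first.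
    rewrite big_ord_recr /= hist_t clrE {3}/value nv; congr (_ + _).
    by apply: eq_bigr => t' _; rewrite histE.
  rewrite big_split /=; apply: leq_add inv2 _; rewrite addn1; apply: leq_trans many _.
  rewrite /matches -sum1_card big_mkcond [leqRHS]big_mkcond /=; apply: leq_sum => u _.
  by rewrite inE andbA; case: (adj v u && _) => //=; case: eqP.
- rewrite uncE => uv; have {}inv3 := inv3 uv.
  case e: (cls (sg v)) => [[y s]|].
    apply: leq_trans inv3; apply/subset_leq_card/subsetP => u; rewrite !inE uncE /avoids !clsE e /=.
    move=> /andP[-> /andP[-> /=]]; case: ifP => // _ /andP[_ ts].
    by have [st _] := inv1 _ _ e; move: ts; rewrite leqNgt st.
  rewrite /avoids clsE e /=; case: ifP => [few|_]; last by rewrite (_ : [set _ | _] = set0) ?cards0 //; apply/setP => u; rewrite !inE !andbF.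
  apply: leq_trans few; apply/subset_leq_card/subsetP => u; rewrite !inE uncE clsE.
  move=> /andP[-> /andP[-> /=]]; rewrite {2}/value.
  case eu: (cls (sg u)) => [[y t']|] /=; first by rewrite {1}/value eu => /andP[].
  by case: ifP => // _ /andP[].
Qed.

(** A node still unsettled after [q] rounds would have met [q * (beta + 1)] collisions. A neighbor
    causes at most [d] before it settles, where two polynomials agree, and at most [d] afterwards,
    where one takes a constant value; [q_large] forbids this. *)
Lemma classesP sg :
  (forall v, clr (sg v) < M) -> (forall u v, adj u v -> clr (sg u) != clr (sg v)) ->
  (forall v, uncol (sg v) -> #|[set u | adj v u & uncol (sg u)]| <= Delta) ->
  let sg' := exec N (classes C f beta q) sg in
  [/\ same_coloring sg sg',
      forall v y t, cls (sg' v) = Some (y, t) -> t < q /\ y < q,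
      forall v, uncol (sg v) -> cls (sg' v) != None
    & forall v, uncol (sg v) ->
        #|[set u | adj v u & uncol (sg u) && avoids (sg' v) (sg' u)]| <= beta].
Proof.
move=> clr_lt clr_ne degD sg'.
pose sg1 := exec_step N (reset_step C) sg.
have loop n : n <= q ->
    let sg2 := exec N [seq class_step C f beta t | t <- iota 0 n] sg1 in
    same_coloring sg sg2 /\ Inv n sg2.
  elim: n => [_|n IH nq]; first split=> [v|v] //.
    split=> // _; rewrite (_ : [set _ | _] = set0) ?cards0 //.
    by apply/setP => u; rewrite !inE /= !andbF.
  rewrite -addn1 iotaD map_cat exec_cat; have [same inv] := IH (ltnW nq).
  rewrite addn1; split; last exact: Inv_step.
  move=> v; have [<- <- <-] := same v; exact: class_step_same.
have [same inv] := loop q (leqnn q).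
rewrite -[exec _ _ sg1]/(exec N (classes C f beta q) sg) -/sg' in same inv.
have uncE u : uncol (sg' u) = uncol (sg u) by rewrite /uncol; have [_ _ ->] := same u.
have clrE u : clr (sg' u) = clr (sg u) by have [_ -> _] := same u.
split=> // v; have [inv1 inv2 inv3] := inv v; first exact: inv1.
  rewrite -uncE => uv; apply/eqP => nv; have := inv2 uv nv; apply/negP; rewrite -ltnNge.
  apply: leq_ltn_trans q_large; apply: leq_trans (_ : \sum_(u | adj v u && uncol (sg' u)) 2 * d <= _).
    apply: leq_sum => u /andP[vu uu]; rewrite !clrE.
    have eq_card_sum (P : pred nat) : \sum_(t < q) (P t : nat) = #|[set t : 'I_q | P t]|.
      by rewrite -sum1_card [RHS]big_mkcond /=; apply: eq_bigr => t _; rewrite inE; case: (P t).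
    rewrite (eq_card_sum (fun t => hist (sg' u) t == f (clr (sg v)) t)).
    have a1 := f_agree (clr_lt u) (clr_lt v) (clr_ne u v _); rewrite adj_sym in a1; have {}a1 := a1 vu.
    have a2 y := f_const (clr (sg v)) y.
    case eu: (cls (sg' u)) => [[y s]|].
      rewrite mul2n -addnn; apply: leq_trans (leq_add a1 (a2 y)).
      apply: leq_trans (leq_card_setU _ _).
      apply/subset_leq_card/subsetP => t; rewrite !inE /hist eu clrE.
      by case: ifP => _ => [->//|]; rewrite (eq_sym y) => ->; rewrite orbT.
    apply: leq_trans (leq_trans a1 _); last by rewrite leq_pmull.
    by apply/subset_leq_card/subsetP => t; rewrite !inE /hist eu clrE.
  rewrite sum_nat_const mulnC leq_mul2l; apply/orP; right.
  rewrite uncE in uv; apply: leq_trans (degD v uv); apply/eq_leq/eq_card => u.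
  by rewrite inE unfold_in /= uncE.
move=> uv; rewrite -uncE in uv; apply: leq_trans (inv3 uv); apply/eq_leq/eq_card => u.
by rewrite !inE uncE.
Qed.

Lemma classes_small s sg v : k < s -> all (small s) (msgs N (classes C f beta q) sg v).
Proof.
move=> ks; have q0 : 0 < q by rewrite expn_gt0.
have qs : q < 2 ^ s by rewrite ltn_exp2l.
have small0 : small s (@nat_msg C 0) by rewrite small_nat_msg // expn_gt0.
rewrite /classes /=; set sg1 := exec_step _ _ _.
have : forall u y t, cls (sg1 u) = Some (y, t) -> y < q by [].
elim: (iota 0 q) sg1 => //= t ts IH sg1 cls_lt.
have value_lt u : value f t (sg1 u) < q.
  by rewrite /value; case e: (cls (sg1 u)) => [[y t']|] //; apply: cls_lt e.
apply/andP; split; first by case: (out_col _) => // ; rewrite small_nat_msg // (leq_ltn_trans (value_lt v)).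
apply: IH => u y t'; rewrite class_stepE; case: ifP => [_ [<- _]|_ /cls_lt] //.
Qed.
End Classes.

(** * Coloring one class *)

Definition msg_set (C : finType) (m : message C) : {set C} :=
  if m is ColorSet A then A else set0.

Definition set_inbox (C : finType) (s : node C) ms : node C :=
  Node (lst s) (clr s) (cls s) ms (out_col s).

Section ColorClass.
Variable C : finType.
Variables (q l : nat) (dec : nat -> {set C} -> nat -> {set C})
  (idx : nat -> {set C} -> seq (nat * {set C}) -> nat).
Variable y : nat.
Implicit Types (s : node C) (ml : seq (message C)).

Definition active s : bool :=
  [&& uncol s, oapp (fun yt => yt.1 == y) false (cls s) & l <= #|lst s|].
Definition join_time s : nat := oapp snd 0 (cls s).
Definition sublist s : {set C} := [set c in take l (enum (lst s))].

(** Color and joining time are packed in base [q]; the successor reserves 0 for inactive nodes. *)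
Definition type_msg s : message C :=
  if active s then nat_msg (clr s * q + join_time s).+1 else nat_msg 0.
Definition set_msg s : message C :=
  if active s then ColorSet (sublist s) else nat_msg 0.

(* In the accessors below, [ml] lists the messages received from one neighbor. *)
Definition nb_active ml : bool := msg_nat (nth (nat_msg 0) ml 0) != 0.
Definition nb_time ml : nat := (msg_nat (nth (nat_msg 0) ml 0)).-1 %% q.
Definition nb_clr ml : nat := (msg_nat (nth (nat_msg 0) ml 0)).-1 %/ q.
Definition nb_set ml : {set C} := msg_set (nth (nat_msg 0) ml 1).
Definition nb_avoid s ml : bool := nb_active ml && (nb_time ml <= join_time s).

Definition my_idx s : nat :=
  idx (clr s) (sublist s) [seq (nb_clr ml, nb_set ml) | ml <- inbox s & nb_avoid s ml].
Definition idx_msg s : message C := nat_msg (if active s then my_idx s else 0).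

Definition my_color s : option C :=
  [pick c in dec (clr s) (sublist s) (my_idx s) |
    all (fun ml => ~~ nb_avoid s ml ||
      (c \notin dec (nb_clr ml) (nb_set ml) (msg_nat (nth (nat_msg 0) ml 2)))) (inbox s)].
(** The position in the broadcast sublist stands for the color, whose own encoding could take
    poly(Delta) bits. *)
Definition color_msg s : message C :=
  nat_msg (if active s then oapp (fun c => index c (enum (sublist s))) 0 (my_color s) else 0).

Definition taken ml : {set C} :=
  if nb_active ml
  then [set c in nb_set ml | index c (enum (nb_set ml)) == msg_nat (nth (nat_msg 0) ml 3)]
  else set0.

Definition record s (ms : seq (message C)) : seq (seq (message C)) :=
  [seq rcons p.1 p.2 | p <- zip (inbox s) ms].

Definition type_step := Step type_msg (fun s ms => set_inbox s [seq [:: m] | m <- ms]).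
Definition set_step := Step set_msg (fun s ms => set_inbox s (record s ms)).
Definition idx_step := Step idx_msg (fun s ms => set_inbox s (record s ms)).
Definition color_step := Step color_msg (fun s ms =>
  Node (lst s :\: \bigcup_(ml <- record s ms) taken ml) (clr s) (cls s) [::]
       (if active s then my_color s else out_col s)).
Definition color_class : seq (step C) := [:: type_step; set_step; idx_step; color_step].

Lemma sublist_sub s : sublist s \subset lst s.
Proof. by apply/subsetP => c; rewrite inE => /mem_take; rewrite mem_enum. Qed.

Lemma card_sublist s : l <= #|lst s| -> #|sublist s| = l.
Proof.
move=> ls; rewrite cardsE (card_uniqP (take_uniq _ (enum_uniq _))) size_takel //.
by rewrite -cardE.
Qed.
End ColorClass.

Record coloring_inv (C : finType) (G : graph) (L : G -> {set C}) (M : nat) (sg : G -> node C) : Prop := {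
  inv_sub : forall v, lst (sg v) \subset L v;
  inv_col : forall v c, out_col (sg v) = Some c -> c \in L v;
  inv_lst : forall u v c, adj u v -> out_col (sg u) = Some c -> out_col (sg v) = None -> c \notin lst (sg v);
  inv_proper : forall u v c, adj u v -> out_col (sg u) = Some c -> out_col (sg v) <> Some c;
  inv_deg : forall v, uncol (sg v) -> #|[set u | adj v u & uncol (sg u)]| < #|lst (sg v)|;
  inv_clr : forall v, clr (sg v) < M;
  inv_clr_ne : forall u v, adj u v -> clr (sg u) != clr (sg v)
}.

(** * Correctness and message sizes of the treatment of one class *)

Section ColorClassCorrect.
Variables (C : finType) (G : graph) (N : network G) (L : G -> {set C}).
Variables (M q beta l r : nat) (dec : nat -> {set C} -> nat -> {set C})
  (idx : nat -> {set C} -> seq (nat * {set C}) -> nat) (y : nat).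
Hypothesis gadget : list_gadget M beta l r dec idx.
Variable sg : G -> node C.
Hypothesis inv : coloring_inv L M sg.
Hypothesis time_lt : forall v z t, cls (sg v) = Some (z, t) -> t < q.
Hypothesis few : forall v, uncol (sg v) ->
  #|[set u | adj v u & uncol (sg u) && avoids (sg v) (sg u)]| <= beta.

Let act v := active l y (sg v).
Let sub v := sublist l (sg v).
Let tmsg v := type_msg q l y (sg v).
Let smsg' v := set_msg l y (sg v).
(** [sg2], [sg3] and [sg4] are closed forms of the states after two, three and four rounds, with
    inboxes expressed through the neighbors. *)
Let sg2 v := set_inbox (sg v) [seq [:: tmsg u; smsg' u] | u <- ports N v].
Let ix v := if act v then my_idx q l idx (sg2 v) else 0.
Let sg3 v := set_inbox (sg v) [seq [:: tmsg u; smsg' u; nat_msg (ix u)] | u <- ports N v].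
Let choice v := my_color q l dec idx (sg3 v).
Let pos v := if act v then oapp (fun c => index c (enum (sub v))) 0 (choice v) else 0.
Let sg4 v := Node
  (lst (sg v) :\: \bigcup_(u <- ports N v) taken [:: tmsg u; smsg' u; nat_msg (ix u); nat_msg (pos u)])
  (clr (sg v)) (cls (sg v)) [::] (if act v then choice v else out_col (sg v)).

Let zip_map (A B D : Type) (h : A * B -> D) (f : G -> A) (g : G -> B) us :
  [seq h p | p <- zip (map f us) (map g us)] = [seq h (f u, g u) | u <- us].
Proof. by elim: us => //= u us ->. Qed.

Let e1 := exec_step N (type_step C q l y) sg.
Let e2 := exec_step N (set_step C l y) e1.
Let e3 := exec_step N (idx_step q l idx y) e2.

Let E1 u : e1 u = set_inbox (sg u) [seq [:: tmsg w] | w <- ports N u].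
Proof. by rewrite /e1 /exec_step /= -map_comp. Qed.

Let E2 u : e2 u = sg2 u.
Proof.
rewrite /e2 /exec_step /= /record !E1 /=; congr (set_inbox _ _).
rewrite (eq_map (g := smsg')) => [|w]; last by rewrite E1.
by rewrite zip_map.
Qed.

Let E3 u : e3 u = sg3 u.
Proof.
rewrite /e3 /exec_step /= /record !E2 /=; congr (set_inbox _ _).
rewrite (eq_map (g := fun w => nat_msg (ix w))) => [|w]; last by rewrite E2.
by rewrite zip_map.
Qed.

Lemma exec_color_class v : exec N (color_class q l dec idx y) sg v = sg4 v.
Proof.
rewrite -[exec _ _ _]/(exec_step N (color_step q l dec idx y) e3) /exec_step /= /record !E3 /=; congr (Node (_ :\: _) _ _ _ _).
rewrite (eq_map (g := fun w => nat_msg (pos w))) => [|w]; last by rewrite E3.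
by rewrite zip_map big_map.
Qed.

Lemma msgs_color_class v : msgs N (color_class q l dec idx y) sg v =
  [:: tmsg v; smsg' v; nat_msg (ix v); nat_msg (pos v)].
Proof.
rewrite -[msgs _ _ _ _]/[:: type_msg q l y (sg v); set_msg l y (e1 v);
  idx_msg q l idx y (e2 v); color_msg q l dec idx y (e3 v)].
by rewrite E1 E2 E3.
Qed.

Let time v := join_time (sg v).
Let nb u := [:: tmsg u; smsg' u].

Let actP v : act v -> [/\ uncol (sg v), cls (sg v) = Some (y, time v), time v < q & l <= #|lst (sg v)|].
Proof.
case/and3P; rewrite /time /join_time; case e: (cls (sg v)) => [[z t]|] //= uv /eqP zy lv.
by rewrite uv lv zy; split=> //; apply: time_lt e.
Qed.

Let nb_activeE u ms : nb_active (nb u ++ ms) = act u.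
Proof. by rewrite /nb_active /= /tmsg /type_msg -/(act u); case: (act u); rewrite nat_msgK. Qed.

Let nb_timeE u ms : act u -> nb_time q (nb u ++ ms) = time u.
Proof.
move=> au; have [_ _ tq _] := actP au.
by rewrite /nb_time /= /tmsg /type_msg -/(act u) au nat_msgK /= modnMDl modn_small.
Qed.

Let nb_clrE u ms : act u -> nb_clr q (nb u ++ ms) = clr (sg u).
Proof.
move=> au; have [_ _ tq _] := actP au.
rewrite /nb_clr /= /tmsg /type_msg -/(act u) au nat_msgK /= divnMDl; last by apply: leq_trans tq.
by rewrite divn_small // addn0.
Qed.

Let nb_setE u ms : act u -> nb_set (nb u ++ ms) = sub u.
Proof. by move=> au; rewrite /nb_set /= /smsg' /set_msg -/(act u) au. Qed.

Let nb_avoidE v u ms ib : nb_avoid q (set_inbox (sg v) ib) (nb u ++ ms) = act u && (time u <= time v).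
Proof.
by rewrite /nb_avoid nb_activeE; case au: (act u) => //=; rewrite nb_timeE.
Qed.

Let avoided v := [seq u <- ports N v | act u && (time u <= time v)].

(** The index reads only the first two messages of each neighbor, so it does not change when the
    inbox grows. *)
Let my_idxE v (ms : G -> seq (message C)) :
  my_idx q l idx (set_inbox (sg v) [seq nb u ++ ms u | u <- ports N v]) =
  idx (clr (sg v)) (sub v) [seq (clr (sg u), sub u) | u <- avoided v].
Proof.
rewrite /my_idx /=; congr (idx _ _ _); rewrite filter_map -map_comp /avoided.
rewrite (eq_filter (a2 := fun u => act u && (time u <= time v))) => [|u]; last by rewrite /= nb_avoidE.
by apply/eq_in_map => u; rewrite mem_filter => /andP[/andP[au _] _]; rewrite /= nb_clrE ?nb_setE.
Qed.

(** The active neighbors to be avoided joined class [y] no later, so [few] bounds their number by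
    [beta] and the gadget applies, whatever indices they chose. *)
Let choiceP v : act v -> ix v < r /\ exists2 c, choice v = Some c &
  [/\ c \in sub v, c \in dec (clr (sg v)) (sub v) (ix v) &
   forall u, adj v u -> act u -> time u <= time v -> c \notin dec (clr (sg u)) (sub u) (ix u)].
Proof.
move=> av; have [uv clsv tv lv] := actP av.
have [dec_sub gad] := gadget.
pose ps := [seq (clr (sg u), sub u) | u <- avoided v].
have sz : size ps <= beta.
  apply: leq_trans (few uv); rewrite size_map size_filter count_ports.
  apply/subset_leq_card/subsetP => u; rewrite !inE => /and3P[-> au tu] /=.
  have [-> clsu _ _] := actP au; by rewrite /avoids clsv clsu eqxx.
have psP : all (fun p : nat * {set C} => [&& p.1 < M, p.1 != clr (sg v) & #|p.2| == l]) ps.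
  apply/allP => _ /mapP[u + ->]; rewrite mem_filter mem_ports => /andP[/andP[au _] vu] /=.
  have [_ _ _ lu] := actP au.
  by rewrite (inv_clr inv) card_sublist // eqxx andbT (inv_clr_ne inv) // adj_sym.
have [ir good] := gad _ _ ps (inv_clr inv v) (card_sublist lv) sz psP.
have ixE : ix v = idx (clr (sg v)) (sub v) ps.
  by rewrite /ix av -(my_idxE v (fun=> [::])).
have ixE3 : my_idx q l idx (sg3 v) = ix v.
  by rewrite ixE -(my_idxE v (fun u => [:: nat_msg (ix u)])).
rewrite -ixE in ir; split=> //.
have [|c cd cn] := good [seq (clr (sg u), sub u, ix u) | u <- avoided v].
  by rewrite -map_comp.
have nbE u : [:: tmsg u; smsg' u; nat_msg (ix u)] = nb u ++ [:: nat_msg (ix u)] by [].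
rewrite /choice /my_color; case: pickP => [c' /andP[]|none]; last first.
  have /negP[] := none c; rewrite ixE3 -/(sub v) ixE; apply/andP; split=> //.
  rewrite all_map; apply/allP => u uv' /=; rewrite nbE nb_avoidE.
  case au: (act u) => //=; case tu: (_ <= _) => //=.
  rewrite nb_clrE // nb_setE // nat_msgK.
  by apply: (cn (clr (sg u), sub u, ix u)); apply: map_f; rewrite mem_filter au tu.
rewrite ixE3 -/(sub v) => c'd; rewrite all_map => /allP c'n; exists c' => //; split=> //.
  by apply: subsetP c'd; apply: dec_sub.
move=> u vu au tu; have := c'n u; rewrite mem_ports /= nbE => /(_ vu).
by rewrite nb_avoidE au tu nb_clrE // nb_setE //= nat_msgK.
Qed.

Let takenE u : taken [:: tmsg u; smsg' u; nat_msg (ix u); nat_msg (pos u)] =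
  if act u then [set c | choice u == Some c] else set0.
Proof.
rewrite -[[:: _; _; _; _]]/(nb u ++ [:: nat_msg (ix u); nat_msg (pos u)]) /taken nb_activeE.
case au: (act u) => //; rewrite nb_setE //= nat_msgK.
have [_ [c cE [csub _ _]]] := choiceP au.
apply/setP => c'; rewrite [LHS]in_set [RHS]in_set /pos au cE /=; apply/idP/eqP => [/andP[c'sub]|[<-]].
  by move/eqP/(congr1 (nth c (enum (sub u)))); rewrite !nth_index ?mem_enum // => ->.
by rewrite csub eqxx.
Qed.

Let lst4E v : lst (sg4 v) = lst (sg v) :\: [set c | [exists u, [&& adj v u, act u & choice u == Some c]]].
Proof.
rewrite /=; congr (_ :\: _); apply/setP => c; rewrite inE.
rewrite bigcup_seq; apply/bigcupP/existsP => [[u]|[u /and3P[vu au cu]]].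
  rewrite mem_ports takenE => vu; case au: (act u); rewrite ?inE // => cu.
  by exists u; rewrite vu au.
by exists u; rewrite ?mem_ports // takenE au inE.
Qed.

Let uncol4 v : uncol (sg4 v) = uncol (sg v) && ~~ act v.
Proof.
rewrite /uncol /=; case av: (act v); last by rewrite andbT.
by have [_ [c -> _]] := choiceP av; rewrite andbF.
Qed.

Let choice_lst v c : act v -> choice v = Some c -> c \in lst (sg v).
Proof.
move=> av cE; have [_ [c' + [csub _ _]]] := choiceP av; rewrite cE => -[->].
by apply: subsetP csub; apply: sublist_sub.
Qed.

(** The end that joined no earlier avoids the whole restricted list of the other end, hence also its
    color. *)
Let choice_proper u v c : adj u v -> act u -> act v -> choice u = Some c -> choice v <> Some c.
Proof.
wlog tuv : u v / time u <= time v => [H uv au av cu cv|uv au av cu cv].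
  case/orP: (leq_total (time u) (time v)) => h; first exact: (H u v).
  by apply: (H v u) => //; rewrite adj_sym.
have [_ [c1 + [_ _ cn]]] := choiceP av; rewrite cv => -[e].
have [_ [c2 + [_ cd _]]] := choiceP au; rewrite cu => -[e'].
have := cn u; rewrite adj_sym uv => /(_ isT au tuv).
by rewrite -e e' cd.
Qed.

Lemma color_classP : let sg' := exec N (color_class q l dec idx y) sg in
  [/\ coloring_inv L M sg',
      forall v, cls (sg' v) = cls (sg v),
      forall v, lst (sg' v) \subset lst (sg v),
      forall v, uncol (sg' v) -> uncol (sg v)
    & forall v t, uncol (sg' v) -> cls (sg v) = Some (y, t) -> #|lst (sg' v)| < l].
Proof.
move=> sg'; have -> : sg' = sg4 by apply: functional_extensionality => v; apply: exec_color_class.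
split=> // [|v|v|v t]; last 3 first.
- by rewrite lst4E subsetDl.
- by rewrite uncol4 => /andP[].
- rewrite uncol4 => /andP[uv nav] e; apply: leq_ltn_trans (subset_leq_card _) (_ : #|lst (sg v)| < _).
    by rewrite lst4E subsetDl.
  by move: nav; rewrite /act /active uv e /= eqxx /= ltnNge.
split=> [v|v c|u v c uv|u v c uv|v|v|u v]; last 2 first.
- exact: inv_clr inv v.
- exact: (inv_clr_ne inv).
- by rewrite lst4E (subset_trans (subsetDl _ _)) ?(inv_sub inv).
- rewrite /=; case av: (act v); last by move/(inv_col inv).
  by move=> /(choice_lst av); apply: subsetP; apply: inv_sub inv v.
- rewrite lst4E !inE /=; case au: (act u) => cu; case av: (act v) => cv.
  + by have [_ [c' + _]] := choiceP av; rewrite cv.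
  + rewrite negb_and negbK; apply/orP; left; apply/existsP; exists u.
    by rewrite adj_sym uv au cu eqxx.
  + by have [_ [c' + _]] := choiceP av; rewrite cv.
  + by rewrite negb_and (inv_lst inv uv cu cv) orbT.
- rewrite /=; case au: (act u) => cu; case av: (act v) => cv.
  + exact: (choice_proper uv au av cu cv).
  + have := inv_lst inv (u := v) (v := u); rewrite adj_sym uv => /(_ c isT cv).
    have [uu _ _ _] := actP au; rewrite (choice_lst au cu) => h.
    by move: uu h; rewrite /uncol; case: (out_col (sg u)) => // _ /(_ erefl).
  + have [uv' _ _ _] := actP av; have := inv_lst inv uv cu; rewrite (choice_lst av cv).
    by move: uv'; rewrite /uncol; case: (out_col (sg v)) => // _ /(_ erefl).
  + exact: (inv_proper inv uv cu cv).
(* Each neighbor colored now removes at most one color from the list and lowers the uncolored degree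
   by one. *)
- rewrite uncol4 lst4E => /andP[uv nav]; have := inv_deg inv uv.
  set X := [set c | [exists u, _]]; set A := [set u | adj v u & uncol (sg u)] => degA.
  pose B := [set u | adj v u & act u].
  have BA : B \subset A.
    by apply/subsetP => u; rewrite !inE => /andP[-> /actP[]].
  have -> : [set u | adj v u & uncol (sg4 u)] = A :\: B.
    by apply/setP => u; rewrite !inE uncol4; case: (adj v u); rewrite //= andbC.
  have XB : #|X| <= #|B|.
    have : X \subset pmap choice (enum B).
      apply/subsetP => c; rewrite inE => /existsP[u /and3P[vu au /eqP cu]].
      by rewrite mem_pmap; apply/mapP; exists u; rewrite ?mem_enum ?inE ?vu ?au.
    move/subset_leq_card/leq_trans; apply; apply: leq_trans (card_size _) _.
    by rewrite size_pmap (leq_trans (count_size _ _)) // -cardE.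
  have := cardsID X (lst (sg v)); have := cardsID B A.
  rewrite (setIidPr BA); have := subset_leq_card (subsetIr (lst (sg v)) X).
  by lia.
Qed.

Lemma color_class_thrifty s : M * q < 2 ^ s -> r <= 2 ^ s -> l <= 2 ^ s ->
  thrifty N s L (color_class q l dec idx y) sg.
Proof.
move=> Ms rs ls v; rewrite exec_color_class msgs_color_class /=.
have s0 : 0 < 2 ^ s by rewrite expn_gt0.
have st : small s (tmsg v).
  rewrite /tmsg /type_msg -/(act v); case: ifP => av; rewrite small_nat_msg //.
  have [_ _ tv _] := actP av; apply: leq_ltn_trans Ms.
  have := inv_clr inv v; rewrite -/(time v); nia.
have si : small s (@nat_msg C (ix v)).
  rewrite small_nat_msg // /ix; case: ifP => // av.
  by have [+ _] := choiceP av; rewrite {1}/ix av => /leq_trans; apply.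
have sp : small s (@nat_msg C (pos v)).
  rewrite small_nat_msg // /pos; case: ifP => // av.
  have [_ [c -> [csub _ _]]] := choiceP av; apply: leq_trans ls.
  have [_ _ _ lv] := actP av.
  by rewrite -[X in _ < X](card_sublist lv) cardE index_mem mem_enum.
rewrite st si sp /=; case av: (act v).
  have [uv _ _ _] := actP av; have [_ [c cE _]] := choiceP av.
  split; first by move: uv; rewrite /uncol; case: (out_col _).
  right; rewrite cE; split=> //; exists [:: tmsg v], [:: nat_msg (ix v); nat_msg (pos v)], (sub v).
  split; rewrite /= ?st ?si ?sp //; first by rewrite /smsg' /set_msg -/(act v) av.
  exact: subset_trans (sublist_sub _ _) (inv_sub inv v).
have ss : small s (smsg' v) by rewrite /smsg' /set_msg -/(act v) av small_nat_msg.
by rewrite ss; split=> //; left.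
Qed.
End ColorClassCorrect.

(** * Levels *)

Lemma coloring_inv_same (C : finType) (G : graph) (L : G -> {set C}) M sg sg' :
  same_coloring sg sg' -> coloring_inv L M sg -> coloring_inv L M sg'.
Proof.
move=> same [i1 i2 i3 i4 i5 i6 i7].
have lE v : lst (sg' v) = lst (sg v) by have [] := same v.
have cE v : clr (sg' v) = clr (sg v) by have [] := same v.
have oE v : out_col (sg' v) = out_col (sg v) by have [] := same v.
have uE v : uncol (sg' v) = uncol (sg v) by rewrite /uncol oE.
split=> [v|v c|u v c uv|u v c uv|v|v|u v uv].
- by rewrite lE.
- by rewrite oE => /i2.
- by rewrite !oE lE; apply: i3.
- by rewrite !oE; apply: i4.
- rewrite uE lE => /i5; congr (_ < _); apply: eq_card => u.
  by rewrite !inE uE.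
- by rewrite cE.
- by rewrite !cE; apply: i7.
Qed.

Definition color_classes (C : finType) q l dec idx n : seq (step C) :=
  flatten [seq color_class q l dec idx y | y <- iota 0 n].

Definition level (C : finType) f beta q l dec idx : seq (step C) :=
  classes C f beta q ++ color_classes q l dec idx q.

(** One reset, [q] rounds of class selection, and four rounds for each of the [q] classes. *)
Lemma size_level (C : finType) f beta q l dec idx :
  size (@level C f beta q l dec idx) = (5 * q).+1.
Proof.
rewrite size_cat /= size_map size_iota /color_classes addSn.
have -> n i : size (flatten [seq color_class q l dec idx y | y <- iota i n]) = 4 * n.
  by elim: n i => //= n IH i; rewrite IH; lia.
by lia.
Qed.

Section Level.
Variables (C : finType) (G : graph) (N : network G) (L : G -> {set C}).
Variables (M k d beta Delta l r s : nat) (f : nat -> nat -> nat).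
Variables (dec : nat -> {set C} -> nat -> {set C})
  (idx : nat -> {set C} -> seq (nat * {set C}) -> nat).
Let q := 2 ^ k.
Hypothesis f_lt : forall x t, f x t < q.
Hypothesis f_agree : forall x y, x < M -> y < M -> x != y ->
  #|[set t : 'I_q | f x t == f y t]| <= d.
Hypothesis f_const : forall x b, #|[set t : 'I_q | f x t == b]| <= d.
Hypothesis q_large : 2 * d * Delta < q * (beta + 1).
Hypothesis gadget : list_gadget M beta l r dec idx.
Hypotheses (M_gt0 : 0 < M) (Ms : M * q < 2 ^ s) (rs : r <= 2 ^ s) (ls : l <= 2 ^ s).

(** Every uncolored node has joined a class; when that class is treated, it is colored unless its
    list is already shorter than [l]. *)
Lemma levelP (sg : G -> node C) : coloring_inv L M sg ->
  (forall v, uncol (sg v) -> #|[set u | adj v u & uncol (sg u)]| <= Delta) ->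
  let sg' := exec N (level f beta q l dec idx) sg in
  [/\ coloring_inv L M sg', forall v, uncol (sg' v) -> #|lst (sg' v)| < l
    & thrifty N s L (level f beta q l dec idx) sg].
Proof.
move=> inv degD sg'; rewrite /sg' exec_cat.
have [same cls_lt cls_ne few] :=
  classesP N f_lt f_agree f_const q_large (inv_clr inv) (inv_clr_ne inv) degD.
set sg1 := exec N (classes C f beta q) sg in same cls_lt cls_ne few *.
have inv1 := coloring_inv_same same inv.
have uncE u : uncol (sg1 u) = uncol (sg u) by rewrite /uncol; have [_ _ ->] := same u.
have few1 v : uncol (sg1 v) -> #|[set u | adj v u & uncol (sg1 u) && avoids (sg1 v) (sg1 u)]| <= beta.
  rewrite uncE => /few; apply: leq_trans; apply/subset_leq_card/subsetP => u.
  by rewrite !inE uncE.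
have loop n : n <= q -> let sg2 := exec N (color_classes q l dec idx n) sg1 in
   [/\ coloring_inv L M sg2, forall v, cls (sg2 v) = cls (sg1 v),
     forall v, uncol (sg2 v) -> uncol (sg1 v),
     forall v y t, uncol (sg2 v) -> cls (sg1 v) = Some (y, t) -> y < n -> #|lst (sg2 v)| < l
   & thrifty N s L (color_classes q l dec idx n) sg1].
  elim: n => [_ /=|n IH nq]; first by split=> //; apply: thrifty_nil.
  have -> : color_classes q l dec idx n.+1 = color_classes q l dec idx n ++ color_class q l dec idx n.
    by rewrite /color_classes -addn1 iotaD map_cat flatten_cat .
  rewrite exec_cat; have [inv2 cls2 unc2 lst2 th2] := IH (ltnW nq).
  set sg2 := exec N (color_classes q l dec idx n) sg1 in inv2 cls2 unc2 lst2 th2 *.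
  have time2 v z t : cls (sg2 v) = Some (z, t) -> t < q by rewrite cls2 => /cls_lt[].
  have few2 v : uncol (sg2 v) -> #|[set u | adj v u & uncol (sg2 u) && avoids (sg2 v) (sg2 u)]| <= beta.
    move=> /unc2/few1; apply: leq_trans; apply/subset_leq_card/subsetP => u.
    by rewrite !inE /avoids !cls2 => /andP[-> /andP[/unc2 -> ->]].
  have [inv3 cls3 lst3 unc3 done3] := color_classP N n gadget inv2 time2 few2.
  split=> [|v|v uv|v y t uv e|].
  - exact: inv3.
  - by rewrite cls3 cls2.
  - exact/unc2/unc3.
  - rewrite ltnS leq_eqVlt => /orP[/eqP yn|yn]; first by apply: (done3 v t); rewrite // cls2 -yn.
    exact: leq_ltn_trans (subset_leq_card (lst3 v)) (lst2 v y t (unc3 v uv) e yn).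
  - exact: thrifty_cat th2 (color_class_thrifty N n gadget inv2 time2 few2 Ms rs ls).
have [inv2 cls2 unc2 lst2 th2] := loop q (leqnn q).
split=> // [v uv|].
  have uv1 := unc2 _ uv; have := cls_ne v; rewrite -uncE uv1 => /(_ isT).
  case e: (cls (sg1 v)) => [[y t]|] // _; apply: (lst2 v y t) => //.
  by have [] := cls_lt _ _ _ e.
apply: (thrifty_cat _ th2) => v; have sm : all (small s) (msgs N (classes C f beta q) sg v).
  apply: classes_small => //; rewrite -(@ltn_exp2l 2) //; apply: leq_ltn_trans Ms.
  by rewrite leq_pmull.
by split; [move=> h; split=> //; have [_ _ ->] := same v | left].
Qed.
End Level.

Definition completes (C : finType) M s Delta (p : seq (step C)) :=
  forall (G : graph) (N : network G) (L : G -> {set C}) (sg : G -> node C),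
    coloring_inv L M sg ->
    (forall v, uncol (sg v) -> #|[set u | adj v u & uncol (sg u)]| <= Delta) ->
    [/\ coloring_inv L M (exec N p sg), forall v, ~~ uncol (exec N p sg v) & thrifty N s L p sg].

(** Nodes left uncolored have lists shorter than [l], hence uncolored degree below [l], and [p]
    takes over. For [l = 1] such a list would be empty, so no node is left. *)
Lemma completes_level (C : finType) mu k d beta Delta l r s
    (dec : nat -> {set C} -> nat -> {set C}) idx (p : seq (step C)) :
  0 < k -> 0 < d -> mu <= k * d -> 2 * d * Delta < 2 ^ k * (beta + 1) ->
  list_gadget (2 ^ mu) beta l r dec idx ->
  mu + k < s -> r <= 2 ^ s -> l <= 2 ^ s ->
  (l = 1 /\ p = [::]) \/ completes (2 ^ mu) s l p ->
  exists p' : seq (step C), size p' = (5 * 2 ^ k).+1 + size p /\ completes (2 ^ mu) s Delta p'.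
Proof.
move=> k0 d0 mukd ql gad mks rs ls pP.
have [f [f_lt f_agree f_const]] := agreement_code k0 d0.
have f_agree' x y : x < 2 ^ mu -> y < 2 ^ mu -> x != y ->
    #|[set t : 'I_(2 ^ k) | f x t == f y t]| <= d.
  have h : 2 ^ mu <= 2 ^ (k * d) by rewrite leq_exp2l.
  by move=> xl yl; apply: f_agree; [apply: leq_trans xl h|apply: leq_trans yl h].
exists (level f beta (2 ^ k) l dec idx ++ p); split; first by rewrite size_cat size_level.
move=> G N L sg inv degD.
have [||inv1 lst1 th1] := levelP (s := s) N f_lt f_agree' f_const ql gad _ _ rs ls inv degD.
- by rewrite expn_gt0.
- by rewrite -expnD ltn_exp2l.
rewrite exec_cat; have deg1 v (uv : uncol _) := ltn_trans (inv_deg inv1 uv) (lst1 v uv).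
case: pP => [[l1 ->]|/(_ G N L _ inv1)[v /deg1/ltnW//|inv2 col2 th2]].
  rewrite cats0; split=> // v; apply/negP => uv.
  by have := leq_ltn_trans (leq0n _) (inv_deg inv1 uv); have := lst1 v uv; rewrite l1; case: #|_|.
by split=> //; apply: thrifty_cat.
Qed.

(** * Initial coloring from the identifiers *)

Section InitialColoring.
Variable C : finType.

Definition recolor_step (F : nat -> seq nat -> nat) : step C :=
  Step (fun s => nat_msg (clr s))
    (fun s ms => Node (lst s) (F (clr s) (map msg_nat ms)) None [::] (out_col s)).

Lemma recolorP (G : graph) (N : network G) D s l l' Fs (sg : G -> node C) :
  reduction_chain D s l Fs l' -> (forall v : G, deg v <= D) ->
  (forall v, clr (sg v) < 2 ^ l) -> (forall u v, adj u v -> clr (sg u) != clr (sg v)) ->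
  let p := map recolor_step Fs in let sg' := exec N p sg in
  [/\ forall v, lst (sg' v) = lst (sg v) /\ out_col (sg' v) = out_col (sg v),
      forall v, clr (sg' v) < 2 ^ l', forall u v, adj u v -> clr (sg' u) != clr (sg' v)
    & forall v, all (small s) (msgs N p sg v)].
Proof.
move=> + degD; elim: Fs l sg => [|F Fs IH] l sg /=; first by move=> ->.
move=> [ls [l1 [F_lt F_ne] ch]] clr_lt clr_ne.
set sg1 := exec_step N (recolor_step F) sg.
have clrE v : clr (sg1 v) = F (clr (sg v)) [seq clr (sg u) | u <- ports N v].
  rewrite /sg1 /exec_step /= -map_comp; congr (F _ _).
  by apply: eq_map => u; rewrite /= nat_msgK.
have [||h1 h2 h3 h4] := IH l1 sg1 ch.
- by move=> v; rewrite clrE.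
- move=> u v uv; rewrite !clrE; apply: F_ne => //; rewrite ?size_map ?size_ports ?degD //.
  + by apply/allP => _ /mapP[w _ ->]; apply: clr_lt.
  + by apply/allP => _ /mapP[w _ ->]; apply: clr_lt.
  + by apply: map_f; rewrite mem_ports.
  + by apply: map_f; rewrite mem_ports adj_sym.
  + by apply/mapP => -[w]; rewrite mem_ports => /clr_ne/eqP.
  + by apply/mapP => -[w]; rewrite mem_ports => /clr_ne/eqP.
split=> // v; rewrite h4 andbT small_nat_msg //.
by apply: leq_trans (clr_lt v) _; rewrite leq_exp2l.
Qed.
End InitialColoring.

(** Successive levels share the exponent [uphalf] in pairs, so the geometric sum is at most 4 times
    its largest power of two after a full pair and 3 times after half a pair. The factor 6 in place
    of 5 absorbs the reset round. *)
Lemma level_size_step x y n (o : bool) :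
  n <= 6 * x * ((3 + ~~ o) * (2 ^ o * y)) -> 0 < x * y ->
  (5 * (x * (2 * y))).+1 + n <= 6 * x * ((3 + ~~ ~~ o) * (2 * y)).
Proof.
by case: o => /=; rewrite ?expn0 ?expn1 !mulnA; set u := x * y; nia.
Qed.

Section Levels.
Variables (C : finType) (mu d lam kap e s : nat).
Hypotheses (d_gt0 : 0 < d) (lam_gt0 : 0 < lam) (kap_gt0 : 0 < kap).
Hypothesis kap_large : 64 * d * lam <= 2 ^ kap.
Hypothesis mu_le : forall j, mu <= (kap + uphalf (e + j)) * d.
Hypotheses (mu_lt : mu + (kap + e) < s) (lam_le : lam <= s).
Hypothesis list_le : forall j, j < e -> 16 * 4 ^ j * lam <= 2 ^ s.
Hypothesis gadgets : forall j, j < e -> exists r dec idx,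
  r <= 2 ^ lam /\ @list_gadget C (2 ^ mu) (2 ^ j) (16 * 4 ^ j * lam) r dec idx.

(* At the level [j] of degree 16 * 4^j * lam, beta is 2^(j-1). The number 2^(kap + (e+j)/2)
   of classes exceeds the required O(2^(kap+j)), so that it is at least a fixed
   power of D and polynomials of constant degree [d] suffice. *)
Lemma completes_levels j : j <= e ->
  exists p : seq (step C), size p <= 6 * 2 ^ kap * ((3 + ~~ odd (e + j)) * 2 ^ uphalf (e + j)) /\
    completes (2 ^ mu) s (16 * 4 ^ j * lam) p.
Proof.
elim: j => [_|j IH je].
  have [dec [idx gad]] := list_gadget0 C (2 ^ mu).
  have [||||||||p [sp cp]] := completes_level (k := kap + uphalf (e + 0)) (d := d)
    (Delta := 16 * 4 ^ 0 * lam) (s := s) (p := [::]) _ _ _ _ gad _ _ _ _ => //.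
  - by rewrite addn_gt0 kap_gt0.
  - rewrite expnD addn0 expn0; have h : 2 ^ kap <= 2 ^ kap * 2 ^ uphalf e by rewrite leq_pmulr ?expn_gt0.
    have := leq_trans kap_large h; have : 0 < d * lam by rewrite muln_gt0 d_gt0.
    rewrite -mulnA; set u := d * lam; set z := _ * _.
    by rewrite (_ : 2 * d * _ = 32 * u) /u; [lia | ring].
  - by apply: leq_trans mu_lt; rewrite addn0 ltnS !leq_add2l; lia.
  - by rewrite expn_gt0.
  - by rewrite expn_gt0.
  - by left.
  exists p; split=> //; rewrite sp addn0 expnD addn0.
  set x := 2 ^ kap; set y := 2 ^ uphalf e; set o := nat_of_bool _.
  have : 0 < x * y by rewrite muln_gt0 !expn_gt0.
  rewrite (_ : 6 * x * _ = 6 * (3 + o) * (x * y)); last by ring.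
  by rewrite /= /o; case: (odd e); lia.
have [p [sp cp]] := IH (ltnW je).
have [r [dec [idx [rle gad]]]] := gadgets je.
have [||||||||p' [sp' cp']] := completes_level (k := kap + uphalf (e + j.+1)) (d := d)
    (Delta := 16 * 4 ^ j.+1 * lam) (s := s) (p := p) _ _ _ _ gad _ _ _ _ => //.
- by rewrite addn_gt0 kap_gt0.
- rewrite expnD (_ : 4 ^ j.+1 = 4 * (2 ^ j * 2 ^ j)); last by rewrite expnS -expnMn.
  (* Since [j < e], the sum [e + j.+1] is at least [2 * j.+1]. *)
  have h : 2 * 2 ^ j <= 2 ^ uphalf (e + j.+1).
    by rewrite -expnS leq_exp2l //; lia.
  have : 0 < 2 ^ uphalf (e + j.+1) by rewrite expn_gt0.
  have : 0 < 2 ^ kap by rewrite expn_gt0.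
  move: h kap_large; set x := 2 ^ j; set y := 2 ^ uphalf _; set z := 2 ^ kap => h1 h2 z0 y0.
  apply: (@leq_ltn_trans (64 * d * lam * (2 * x) * x)); first by apply/eq_leq; ring.
  apply: (@leq_ltn_trans (z * y * x)); first by rewrite leq_mul2r leq_mul ?orbT.
  by rewrite addn1 mulnS -[X in X < _]add0n ltn_add2r muln_gt0 z0.
- by apply: leq_trans mu_lt; rewrite ltnS !leq_add2l; lia.
- by apply: leq_trans rle _; rewrite leq_exp2l.
- exact: list_le.
- by right.
exists p'; split=> //; rewrite sp'.
have -> : uphalf (e + j.+1) = ((e + j)./2).+1 by rewrite addnS.
have -> : odd (e + j.+1) = ~~ odd (e + j) by rewrite addnS.
rewrite uphalf_half in sp; set m := e + j in sp *.
rewrite expnD expnS; set x := 2 ^ kap in sp *; set y := 2 ^ m./2.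
rewrite expnD -/y in sp; have : 0 < x * y by rewrite muln_gt0 !expn_gt0.
exact: level_size_step.
Qed.
End Levels.

(** * Choice of the parameters *)

Lemma expn_up_log_leq x : 0 < x -> 2 ^ up_log 2 x <= 2 * x.
Proof.
case: x => [|[|x]] // _; rewrite ?up_log1 //.
have := @up_log_gtn 2 x.+2 isT isT; have : 0 < up_log 2 x.+2 by rewrite up_log_gt0.
by case: (up_log _ _) => // k _ /=; rewrite expnS => /ltnW; rewrite leq_mul2l => ->.
Qed.

Lemma gadgets_exist a b c D (C : finType) e :
  let m := 2 * b + 22 in let lam := (c + 2 + (2 * m + 2 * a + 3)) * up_log 2 D.+1 in
  0 < D -> #|C| <= 2 ^ (a * D ^ c) -> 16 * 4 ^ e * lam < D ->
  exists r dec idx, r <= 2 ^ lam /\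
    @list_gadget C (2 ^ (m * up_log 2 D.+1)) (2 ^ e) (16 * 4 ^ e * lam) r dec idx.
Proof.
move=> m lam D0 cardC lD; set mu := m * _.
have Lam0 : 0 < up_log 2 D.+1 by rewrite up_log_gt0.
have LamD : up_log 2 D.+1 <= D by apply: up_log_min => //; apply: ltn_expl.
(* [t] makes [4 * (2 ^ mu * #|C| ^ l) ^ 2 < 2 ^ t] hold for [l = 16 * 4 ^ e * lam < D]. Since
   [t <= X * D ^ (c + 1)] and [2 ^ e <= D], the choice of [lam] gives [2 ^ e * t <= 2 ^ lam]. *)
pose X := 2 * m + 2 * a + 3; pose t := 2 * (mu + a * D ^ c * D) + 3.
have lam0 : 0 < lam by rewrite muln_gt0 Lam0 andbT; lia.
have Dc : 0 < D ^ c by rewrite expn_gt0 D0.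
have tX : t <= X * (D ^ c * D).
  have : mu <= m * (D ^ c * D) by rewrite leq_mul2l (leq_trans LamD) ?orbT ?leq_pmull.
  have : 0 < D ^ c * D by rewrite muln_gt0 Dc.
  by rewrite /t /X -mulnA; set z := D ^ c * D; lia.
have eD : 2 ^ e <= D.
  apply: leq_trans (ltnW lD); apply: leq_trans (_ : 4 ^ e <= _); first by case: {lD} e => // e; rewrite leq_exp2r.
  by rewrite mulnAC leq_pmull // muln_gt0.
have rle : 2 ^ e * t <= 2 ^ lam.
  apply: leq_trans (leq_mul eD tX) _.
  rewrite (_ : D * _ = X * D ^ (c + 2)); last by rewrite expnD; ring.
  have -> : lam = X * up_log 2 D.+1 + (c + 2) * up_log 2 D.+1 by rewrite /lam /X; ring.
  rewrite [2 ^ _]expnD leq_mul //.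
    by apply: leq_trans (ltnW (ltn_expl X (isT : 1 < 2))) _; rewrite leq_exp2l // leq_pmulr.
  by rewrite mulnC expnM leq_exp2r ?addn2 // ltnW // up_logP.
have [|||||dec [idx gad]] := @list_gadget_exists C (2 ^ mu) (2 ^ e) lam t _ _ _ _ rle; rewrite ?expn_gt0 //.
- by rewrite /t addn3.
- rewrite (_ : (2 ^ e) ^ 2 = 4 ^ e); last by rewrite -expnM mulnC expnM.
  have h : #|C| ^ (16 * 4 ^ e * lam) <= 2 ^ (a * D ^ c * D).
    apply: leq_trans (_ : (2 ^ (a * D ^ c)) ^ (16 * 4 ^ e * lam) <= _).
      by rewrite leq_exp2r // muln_gt0 lam0 andbT muln_gt0 expn_gt0.
    by rewrite -expnM leq_exp2l // leq_mul2l ltnW ?orbT.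
  apply: (@leq_ltn_trans (4 * (2 ^ mu * 2 ^ (a * D ^ c * D)) ^ 2)).
    by rewrite leq_mul2l leq_exp2r // leq_mul2l h orbT.
  rewrite -expnD -expnM (_ : 4 = 2 ^ 2) // -expnD ltn_exp2l // /t; lia.
exists (2 ^ e * t), dec, idx; split=> //.
by move: gad; rewrite (_ : (2 ^ e) ^ 2 = 4 ^ e) // -expnM mulnC expnM.
Qed.

Lemma completes_exists a b c : exists K B, forall n D (C : finType),
  0 < D -> D < n -> #|C| <= 2 ^ (a * D ^ c) ->
  exists (p : seq (step C)) Z,
  [/\ size p < Z, Z ^ 2 <= K * (D * up_log 2 D.+1), b * up_log 2 n + 1 <= B * up_log 2 n &
      completes (2 ^ ((2 * b + 22) * up_log 2 D.+1)) (B * up_log 2 n) D p].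
Proof.
pose m := 2 * b + 22; pose d := 4 * m; pose C0 := c + 2 + (2 * m + 2 * a + 3).
pose B := m + 9 + d + 2 * C0 + b.
exists ((6145 * d * C0) ^ 2), B => n D C D0 Dn cardC.
set Lam := up_log 2 D.+1; set nu := up_log 2 n; pose mu := m * Lam.
have Lam0 : 0 < Lam by rewrite up_log_gt0.
have Lamnu : Lam <= nu by apply: leq_up_log.
have LamD : Lam <= D by apply: up_log_min => //; apply: ltn_expl.
have DLam : D < 2 ^ Lam by apply: up_logP.
pose lam := C0 * Lam.
have C00 : 0 < C0 by rewrite /C0; lia.
have lam0 : 0 < lam by rewrite muln_gt0 C00.
have d0 : 0 < d by rewrite /d /m; lia.
have ex_e : exists e, D <= 16 * 4 ^ e * lam.
  exists D; apply: leq_trans (ltnW (ltn_expl D (isT : 1 < 4))) _.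
  by rewrite mulnAC leq_pmull // muln_gt0.
(* The top level is the first whose degree reaches [D]; minimality keeps [lam * 4 ^ e] in O(D). *)
case: (ex_minnP ex_e) => e De min_e.
have lD j : j < e -> 16 * 4 ^ j * lam < D.
  by move=> je; rewrite ltnNge; apply/negP => /min_e; rewrite leqNgt je.
have e_le : e <= Lam.
  case: e lD {De min_e} => // e /(_ e (leqnn _)) lD.
  have : 2 ^ e < 2 ^ Lam.
    apply: leq_ltn_trans DLam; apply: leq_trans (ltnW lD).
    apply: leq_trans (_ : 4 ^ e <= _); first by case: e {lD} => // e; rewrite leq_exp2r.
    by rewrite mulnAC leq_pmull // muln_gt0.
  by rewrite ltn_exp2l.
have four_e : lam * 4 ^ e <= C0 * D.
  case: e lD {De min_e e_le} => [_|e /(_ e (leqnn _)) lD].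
    by rewrite muln1 leq_mul2l LamD orbT.
  have : lam * 4 ^ e.+1 <= D by rewrite expnS; move: lD; set z := 4 ^ e; nia.
  by move/leq_trans; apply; rewrite leq_pmull.
pose kap := 6 + up_log 2 d + up_log 2 lam.
have kap_up : 2 ^ kap <= 256 * d * lam.
  rewrite /kap !expnD; have := leq_mul (expn_up_log_leq d0) (expn_up_log_leq lam0).
  by rewrite -mulnA; set z := _ * 2 ^ _; lia.
have kap_low : 64 * d * lam <= 2 ^ kap.
  by rewrite /kap !expnD !leq_mul // up_logP.
have kap_le : kap <= 6 + d + lam by rewrite /kap !leq_add // up_log_leq.
pose s := B * nu.
have s_large : mu + (kap + e) < s.
  rewrite /s /B; apply: (@leq_trans ((m + 9 + d + 2 * C0 + b) * Lam)); last by rewrite leq_mul2l Lamnu orbT.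
  rewrite /mu; move: kap_le; rewrite /lam; nia.
have lam_s : lam <= s.
  by rewrite /s /B; apply: leq_mul => //; lia.
have Lam_s : Lam <= s by rewrite /s -[Lam]mul1n leq_mul // /B; lia.
(* [D <= 16 * 4 ^ e * lam] bounds [Lam] by [5 + 2 * e + up_log 2 lam], at most four times the
   exponent of the field size; hence [d = 4 * m]. *)
have mu_le j : mu <= (kap + uphalf (e + j)) * d.
  have h : Lam <= 4 * (kap + uphalf (e + j)).
    have : Lam <= 5 + e + e + up_log 2 lam.
      apply: up_log_min => //; rewrite !expnD.
      apply: leq_ltn_trans De _; have := up_logP lam (isT : 1 < 2).
      rewrite (_ : 4 ^ e = 2 ^ e * 2 ^ e); last by rewrite -expnMn.
      set x := 2 ^ e; set y := 2 ^ up_log _ _ => lamy.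
      apply: (@leq_ltn_trans (16 * (x * x) * y)); first by rewrite leq_mul2l lamy orbT.
      have : 0 < x * x * y by rewrite !muln_gt0 !expn_gt0.
      rewrite -mulnA (_ : 2 ^ 5 * x * x * y = 32 * (x * x * y)); last by rewrite -!mulnA.
      by set w := x * x * y; lia.
    by rewrite /kap; lia.
  have -> : (kap + uphalf (e + j)) * d = m * (4 * (kap + uphalf (e + j))) by rewrite /d; ring.
  by rewrite leq_mul2l h orbT.
have [|||p [sp cp]] := @completes_levels C mu d lam kap e s d0 lam0 _ kap_low mu_le s_large lam_s _ _ e (leqnn e).
- by [].
- by move=> j /lD/ltnW/leq_trans; apply; apply: leq_trans (ltnW DLam) _; rewrite leq_exp2l.
- by move=> j /lD; apply: gadgets_exist.
(* At [j = e] the total is at most [24 * 2 ^ kap * 2 ^ e] with [2 ^ kap <= 256 * d * lam]; 6145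
   exceeds [24 * 256] by one to make the bound strict. *)
exists p, (6145 * d * lam * 2 ^ e); split.
- apply: leq_ltn_trans sp _; rewrite addnn odd_double uphalf_double.
  apply: (@leq_ltn_trans (24 * (256 * d * lam) * 2 ^ e)).
    rewrite (_ : 6 * _ * _ = 24 * 2 ^ kap * 2 ^ e) ?leq_mul2r ?leq_mul2l ?kap_up ?orbT //.
    by rewrite /=; ring.
  rewrite (_ : 24 * _ = 6144 * d * lam); last by ring.
  by rewrite ltn_mul2r expn_gt0 /= ltn_mul2r lam0 ltn_mul2r d0.
- rewrite (_ : _ ^ 2 = (6145 * d) ^ 2 * lam * (lam * (2 ^ e) ^ 2)); last by ring.
  rewrite (_ : (2 ^ e) ^ 2 = 4 ^ e); last by rewrite -expnM mulnC expnM.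
  apply: leq_trans (leq_mul (leqnn _) four_e) _.
  by apply/eq_leq; rewrite /lam; ring.
- apply: (@leq_trans ((b + 1) * nu)); first by rewrite mulnDl mul1n leq_add2l (leq_trans Lam0).
  by rewrite leq_mul2r /B; apply/orP; right; lia.
- move=> G N L sg inv degD; apply: cp => // v uv; exact: leq_trans (degD v uv) De.
Qed.

(** * Assembling the algorithm and bounding its rounds *)

Import Order.TTheory GRing.Theory Num.Theory.

Lemma program_solves b n D (C : finType) Fs (p : seq (step C)) s :
  reduction_chain D (b * up_log 2 n + 1) (b * up_log 2 n + 1) Fs ((2 * b + 22) * up_log 2 D.+1) ->
  b * up_log 2 n + 1 <= s -> completes (2 ^ ((2 * b + 22) * up_log 2 D.+1)) s D p ->
  forall (G : graph) (N : network G) (L : G -> {set C}), max_deg G = D ->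
    (forall v, size (node_id N v) <= b * up_log 2 n) -> (forall v, deg v + 1 <= #|L v|) ->
  let q := map (@recolor_step C) Fs ++ p in
  (exists col : G -> C, is_list_coloring L col /\
     forall v, output (run (prog_alg q) N L (size q) v) = Some (col v))
  /\ forall v, single_list_broadcast (prog_alg q) N L (size q) s v.
Proof.
move=> ch ls comp G N L degG id_le deg_lt q.
have degD (v : G) : deg v <= D by rewrite -degG; apply: leq_bigmax.
have [||same1 clr1 ne1 small1] := recolorP (sg := sg0 N L) N ch degD.
- move=> v; apply: leq_trans (ltn_nat_of_bits _) _.
  by rewrite leq_exp2l // addn1 ltnS.
- move=> u v; apply: contraTneq => /nat_of_bits_inj/node_id_inj ->.
  by rewrite adj_irr.
set p1 := map _ Fs in same1 clr1 ne1 small1 q *.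
set sg1 := exec N p1 (sg0 N L) in same1 clr1 ne1.
have lst1 v : lst (sg1 v) = L v by have [] := same1 v.
have col1 v : out_col (sg1 v) = None by have [] := same1 v.
have inv1 : coloring_inv L (2 ^ ((2 * b + 22) * up_log 2 D.+1)) sg1.
  split=> [v|v c|u v c _|u v c _|v _|v|u v].
  - by rewrite lst1.
  - by rewrite col1.
  - by rewrite col1.
  - by rewrite col1.
  - rewrite lst1; apply: leq_trans (deg_lt v); rewrite addn1 ltnS.
    by apply/subset_leq_card/subsetP => u; rewrite !inE => /andP[].
  - exact: clr1.
  - exact: ne1.
have [v _|inv2 col2 th2] := comp G N L sg1 inv1.
  apply: leq_trans (degD v).
  by apply/subset_leq_card/subsetP => u; rewrite !inE => /andP[].
have th : thrifty N s L q (sg0 N L).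
  apply: thrifty_cat th2 => v.
  have sm : all (small s) (msgs N p1 (sg0 N L) v).
    by apply: sub_all (small1 v) => -[w|S] //; rewrite /small => /leq_trans; apply.
  by split=> //; left.
split=> [|v]; last exact: thrifty_broadcast.
have outE v : output (run (prog_alg q) N L (size q) v) = out_col (exec N p sg1 v).
  by rewrite run_prog // take_size /= exec_cat.
have h v : {c | out_col (exec N p sg1 v) = Some c}.
  by have := col2 v; rewrite /uncol; case: (out_col _) => // c _; exists c.
exists (fun v => sval (h v)); split; last by move=> v; rewrite outE; exact: svalP (h v).
split=> [v|u v uv]; first by apply: (inv_col inv2); exact: svalP (h v).
apply/eqP => e; have := inv_proper inv2 uv (svalP (h u)).
by rewrite e; apply; exact: svalP (h v).
Qed.

(** Edgeless graphs are treated apart, in no round: for [D = 0] the bound does not pay for the round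
    of Linial's reduction. *)
Definition pick_alg (C : finType) : local_alg {set C} (message C) C :=
  LocalAlg (state := option C) (fun _ _ (S : {set C}) => [pick c in S]) (fun _ _ => Bits C [::])
    (fun s _ => s) (fun s => s).

Lemma pick_alg_solves (C : finType) (G : graph) (N : network G) (L : G -> {set C}) s :
  max_deg G = 0 -> (forall v, deg v + 1 <= #|L v|) ->
  (exists col : G -> C, is_list_coloring L col /\
     forall v, output (run (pick_alg C) N L 0 v) = Some (col v))
  /\ forall v, single_list_broadcast (pick_alg C) N L 0 s v.
Proof.
move=> deg0 deg_lt; split=> [|v]; last by exists 0, set0; split=> //; apply: sub0set.
have h v : {c | [pick c in L v] = Some c & c \in L v}.
  case: pickP => [c cL|none]; first by exists c.
  by exfalso; have := deg_lt v; rewrite addn1 (eq_card0 none).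
exists (fun v => s2val (h v)); split; last by move=> v; exact: s2valP (h v).
split=> [v|u v uv]; first exact: s2valP' (h v).
have : deg u <= max_deg G by apply: leq_bigmax.
by rewrite deg0 leqn0 cards_eq0 => /eqP/setP/(_ v); rewrite !inE uv.
Qed.

Lemma max_deg_ltn (G : graph) : 0 < max_deg G -> max_deg G < #|G|.
Proof.
have : max_deg G <= #|G|.-1.
  apply/bigmax_leqP => v _; rewrite -(cardsC1 v); apply/subset_leq_card/subsetP => u.
  by rewrite !inE; apply: contraTneq => ->; rewrite adj_irr.
by move=> h1 h2; lia.
Qed.

Local Open Scope ring_scope.

(** Rounding up adds at most one to the binary logarithm of [D], and both are at most that of
    [maxn 2 D]. *)
Lemma up_log_ln (R : realType) (D : nat) : (0 < D)%N ->
  (up_log 2 D.+1)%:R * ln 2 <= 2 * ln (maxn 2 D)%:R :> R.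
Proof.
move=> D0; set Lam := up_log 2 D.+1.
have Lam0 : (0 < Lam)%N by rewrite up_log_gt0.
have max0 : 0 < (maxn 2 D)%:R :> R by rewrite ltr0n leq_max.
have l2 : ln 2 <= ln (maxn 2 D)%:R :> R.
  by rewrite ler_ln ?posrE // ler_nat leq_maxl.
have lD : Lam.-1%:R * ln 2 <= ln (maxn 2 D)%:R :> R.
  have -> : Lam.-1%:R * ln 2 = ln (2 ^+ Lam.-1) :> R by rewrite lnXn // mulr_natl.
  rewrite ler_ln ?posrE ?exprn_gt0 // -natrX ler_nat leq_max.
  by apply/orP; right; rewrite -ltnS; apply: up_log_gtn.
rewrite -(prednK Lam0) -natr1; lra.
Qed.

Lemma round_bound (R : realType) (K D Z : nat) : (0 < D)%N ->
  (Z ^ 2 <= K * (D * up_log 2 D.+1))%N ->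
  Z%:R <= Num.sqrt (K%:R * (2 / ln 2)) * Num.sqrt (D%:R * ln (maxn 2 D)%:R) :> R.
Proof.
move=> D0 ZK; have ln2 : 0 < ln 2 :> R by rewrite ln_gt0 // ltr1n.
have lnm : 0 <= ln (maxn 2 D)%:R :> R by rewrite ln_ge0 // ler1n leq_max.
rewrite -sqrtrM; last by rewrite mulr_ge0 // divr_ge0 // ltW.
rewrite -[Z%:R]ger0_norm ?ler0n // -sqrtr_sqr ler_wsqrtr //.
rewrite -natrX; apply: le_trans (_ : (K * (D * up_log 2 D.+1))%:R <= _).
  by rewrite ler_nat.
rewrite !natrM -mulrA ler_wpM2l // mulrCA ler_wpM2l //.
by rewrite mulrAC ler_pdivlMr // up_log_ln.
Qed.

Theorem theorem3 (R : realType) (a c b : nat) :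
  exists (K : R) (B : nat),
  forall (n D : nat) (C : finType), (#|C| <= 2 ^ (a * D ^ c))%N ->
  exists (A : local_alg {set C} (message C) C) (T : nat),
    T%:R <= K * Num.sqrt (D%:R * ln (maxn 2 D)%:R) + 1 / 2 * (log_star n)%:R
    /\ forall (G : graph) (N : network G) (L : G -> {set C}),
      #|G| = n -> max_deg G = D ->
      (forall v, size (node_id N v) <= b * up_log 2 n)%N ->
      (forall v, deg v + 1 <= #|L v|)%N ->
      (exists col : G -> C, is_list_coloring L col /\
         forall v, output (run A N L T v) = Some (col v))
      /\ forall v, single_list_broadcast A N L T (B * up_log 2 n) v.
Proof.
have [K [B prog]] := completes_exists a b c.
exists (Num.sqrt (K%:R * (2 / ln 2))), B => n D C cardC.
have bound0 : 0 <= Num.sqrt (K%:R * (2 / ln 2)) * Num.sqrt (D%:R * ln (maxn 2 D)%:R)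
    + 1 / 2 * (log_star n)%:R :> R.
  by rewrite addr_ge0 // mulr_ge0 ?sqrtr_ge0 // divr_ge0.
have [D0|D0] := posnP D.
  exists (pick_alg C), 0%N; split=> // G N L _ degG _ deg_lt.
  by apply: pick_alg_solves => //; rewrite degG.
(* A positive maximum degree is below the number of nodes, so for [n <= D] no graph qualifies and
   any algorithm will do. *)
have [nD|Dn] := leqP n D.
  exists (pick_alg C), 0%N; split=> // G N L cardG degG.
  by have := @max_deg_ltn G; rewrite cardG degG => /(_ D0); rewrite ltnNge nD.
have [Fs szF ch] := coloring_chain b D0 Dn.
have [p [Z [sp ZK sB comp]]] := prog n D C D0 Dn cardC.
exists (prog_alg (map (@recolor_step C) Fs ++ p)), (size (map (@recolor_step C) Fs ++ p)).
split; last by move=> G N L _ degG id_le deg_lt; exact: program_solves ch sB comp _ N L degG id_le deg_lt.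
(* The strict inequality [size p < Z] absorbs the round of Linial's reduction. *)
rewrite size_cat size_map szF addrC; apply: le_trans (_ : ((log_star n)./2 + Z)%:R <= _).
  by rewrite ler_nat -addnA leq_add2l add1n.
rewrite natrD lerD //; last exact: round_bound.
have : (2 * (log_star n)./2)%:R <= (log_star n)%:R :> R by rewrite ler_nat; lia.
by rewrite natrM; lra.
Qed.
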